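(* Let $\mathrm d\Psi$ be a $q\times p$ matrix of measures with all moments finite that is weakly normal along the step-line, with recurrence matrix $T$ and nonsingular lower triangular initial-condition matrices $\xi,\nu$, and let $T=L_1\cdots L_pU_q\cdots U_1$ be a positive bidiagonal factorization. Suppose that the two one-sided Christoffel chains $\mathrm d\Psi\,(\mathsf K_p^{a})^{\mathsf T}$ $(0\le a\le p)$ and $\mathsf K_q^{b}\,\mathrm d\Psi$ $(0\le b\le q)$ are weakly normal, and that this factorization is the Christoffel factorization of the system: $L_a$ is the normalized column-side connection matrix from $\mathrm d\Psi(\mathsf K_p^{a-1})^{\mathsf T}$ to $\mathrm d\Psi(\mathsf K_p^{a})^{\mathsf T}$ for $1\le a\le p$, and $U_b$ is the normalized row-side connection matrix from $\mathsf K_q^{b-1}\mathrm d\Psi$ to $\mathsf K_q^{b}\mathrm d\Psi$ for $1\le b\le q$. Let $\mathcal L_{b,a},\mathcal U_{b,a}$ be the positive bidiagonal edge matrices of the rectangle determined by these boundary factors (see context). For every vertex $(b,a)$, $0\le b\le q$, $0\le a\le p$, the matrices $\mathcal L_{b,a}$ and $\mathcal U_{b,a}$ are the normalized column-side and row-side connection matrices on the corresponding edges. The right and left recurrence polynomials and their initial-condition matrices obtained by transporting $(T,\xi,\nu)$ along a path from $(0,0)$ to $(b,a)$ are independent of that path. Denote them by $\boldsymbol B_{(b,a)},\boldsymbol A_{(b,a)},\xi_{(b,a)},\nu_{(b,a)}$, and denote their recurrence matrix by $T_{(b,a)}$. Their reconstructed scalar moment matrix, with $(qu+j,pv+i)$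 entry equal to the $(j,i)$ entry ($0\le j<q$, $0\le i<p$) of $\xi_{(b,a)}^{-1}\mathsf E_{[q]}T_{(b,a)}^{u+v}\mathsf E_{[p]}^{\mathsf T}\nu_{(b,a)}^{-\mathsf T}$, equals the shifted matrix \[ \mathscr M^{\langle b,a\rangle}=\bigl[\mathscr M_{r+b,s+a}\bigr]_{r,s\ge0}. \] The matrix of measures \[ \mathrm d\Psi_{(b,a)}(x)=\mathsf K_q(x)^b\,\mathrm d\Psi(x)\,\bigl(\mathsf K_p(x)^a\bigr)^{\mathsf T} \] represents the reconstructed moment matrix. In particular, for every $n\in\mathbb N_0$, \[ \xi_{(b,a)}^{-1}\mathsf E_{[q]}T_{(b,a)}^n\mathsf E_{[p]}^{\mathsf T}\nu_{(b,a)}^{-\mathsf T}=\int x^n\,\mathrm d\Psi_{(b,a)}(x). \] The right and left polynomial solutions of the recurrence for $T_{(b,a)}$, normalized by $\xi_{(b,a)}$ and $\nu_{(b,a)}$, are the mixed-type multiple orthogonal polynomials for $\mathrm d\Psi_{(b,a)}$.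
   Context: Let $p,q\ge1$. All semi-infinite matrices are indexed by $\mathbb N_0$; $\mathsf E_{[r]}=[\,I_r\ 0\ 0\cdots]$; $X^{-\mathsf T}=(X^{-1})^{\mathsf T}$. A lower bidiagonal $L$ is normalized if $L_{n,n}=1$, an upper bidiagonal $U$ is normalized if $U_{n,n+1}=1$; positive means that the remaining entries ($L_{n+1,n}$, resp. $U_{n,n}$) are all $>0$; in a positive bidiagonal factorization all factors are normalized positive. $\mathsf K_r(x)$ is the $r\times r$ matrix with $1$'s on the first superdiagonal, $x$ in the lower left corner and zeros elsewhere ($\mathsf K_1(x)=x$), so $\mathsf K_r(x)^r=xI_r$. Scalar step-line moment matrix of $\mathrm d\Psi$: $\mathscr M_{qu+j,pv+i}=\int x^{u+v}\mathrm d\Psi_{j,i}(x)$, $0\le j<q$, $0\le i<p$. Weakly normal means all leading principal minors of $\mathscr M$ are nonzero (equivalently, each step-line orthogonality problem has a one-dimensional solution space). Step-line spaces: at position $n=qm+j$ the right space consists of row vectors of $q$ polynomials with $s$-th component of degree $\le m$ if $s\le j$, $\le m-1$ if $s>j$; at position $n=pm+i$ the left space consists of column vectors of $p$ polynomials with $s$-th component of degree $\le m$ if $s\le i$, $\le m-1$ if $s>i$. The mixed-type multiple orthogonal polynomials of a weakly normal $\mathrm d\Psi$ are arrays $\boldsymbol B$ (semi-infinite by $q$) and $\boldsymbol A$ ($p$ by semi-infinite), whose $n$-th row, resp. column, lies in the space at position $n$, with $\int\boldsymbol B\,\mathrm d\Psi\,\boldsymbol A=I$. The initial-condition matrices are $\xi=\mathsf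 E_{[q]}\boldsymbol B$ and $\nu^{\mathsf T}=\boldsymbol A\mathsf E_{[p]}^{\mathsf T}$; the recurrence matrix $\mathcal T$ satisfies $\mathcal T\boldsymbol B=x\boldsymbol B$, $\boldsymbol A\mathcal T=x\boldsymbol A$. Connection matrices: for a system $\mathrm d\Psi_{0,0}$ with arrays $\boldsymbol B_{0,0},\boldsymbol A_{0,0}$ and its transforms $\mathrm d\Psi_{0,1}=\mathrm d\Psi_{0,0}\mathsf K_p^{\mathsf T}$, $\mathrm d\Psi_{1,0}=\mathsf K_q\mathrm d\Psi_{0,0}$ (arrays normalized by the one-step formulas), the normalized column-side connection matrix is the normalized lower bidiagonal $L$ with $\boldsymbol A_{0,0}L=\mathsf K_p^{\mathsf T}\boldsymbol A_{0,1}$, $L\boldsymbol B_{0,1}=\boldsymbol B_{0,0}$; the normalized row-side connection matrix is the normalized upper bidiagonal $U$ with $U\boldsymbol B_{0,0}=\boldsymbol B_{1,0}\mathsf K_q$, $\boldsymbol A_{1,0}U=\boldsymbol A_{0,0}$. Edge matrices: $\mathcal L_{b,a}$ ($0\le b\le q$, $0\le a\le p-1$) is attached to the edge $(b,a)\to(b,a+1)$ and $\mathcal U_{b,a}$ ($1\le b\le q$, $0\le a\le p$) to the edge $(b-1,a)\to(b,a)$. They are the unique normalized positive lower, resp. upper, bidiagonal matrices with $\mathcal U_{b,0}=U_b$, $\mathcal L_{0,a}=L_{a+1}$ and $\mathcal U_{b,a}\mathcal L_{b-1,a}=\mathcal L_{b,a}\mathcal U_{b,a+1}$ for all $1\le b\le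 q$, $0\le a\le p-1$. Transport along an edge $(b,a)\to(b,a+1)$ replaces $(\boldsymbol B,\boldsymbol A)$ by $(\mathcal L_{b,a}^{-1}\boldsymbol B,\ (\mathsf K_p^{\mathsf T})^{-1}\boldsymbol A\mathcal L_{b,a})$; along $(b-1,a)\to(b,a)$ it replaces $(\boldsymbol B,\boldsymbol A)$ by $(\mathcal U_{b,a}\boldsymbol B\mathsf K_q^{-1},\ \boldsymbol A\,\mathcal U_{b,a}^{-1})$; initial-condition matrices are read off from the resulting arrays. Paths from $(0,0)$ to $(b,a)$ are monotone paths made of such edges. *)

(* Defs.v *)
From HB Require Import structures.
From mathcomp Require Import all_boot all_order all_algebra.
From mathcomp Require Import all_classical all_reals all_analysis.

Set Implicit Arguments.
Unset Strict Implicit.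
Unset Printing Implicit Defensive.

Import Order.TTheory GRing.Theory Num.Theory.
Import numFieldNormedType.Exports.

Local Open Scope classical_set_scope.
Local Open Scope ring_scope.

(* A matrix whose rows and columns are indexed by nat or by some 'I_n is a
   function of its two indices.  Entries of a product are finitely supported
   sums; they are 0 by convention when the support is infinite, which does not
   occur for the products formed below. *)
Definition mulm (S : pzSemiRingType) (I J : Type) (K : choiceType)
    (X : I -> K -> S) (Y : K -> J -> S) : I -> J -> S :=
  fun i j => \sum_(k \in [set: K]) (X i k * Y k j).

Notation "X ** Y" := (mulm X Y) (at level 40, left associativity) : ring_scope.

Definition trm (S I J : Type) (X : I -> J -> S) : J -> I -> S :=
  fun j i => X i j.

Definition mapm (S S' I J : Type) (f : S -> S') (X : I -> J -> S) :
    I -> J -> S' :=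
  fun i j => f (X i j).

Definition scalem (S : pzSemiRingType) (I J : Type) (c : S) (X : I -> J -> S) :
    I -> J -> S :=
  fun i j => c * X i j.

Definition idm (S : pzSemiRingType) : nat -> nat -> S :=
  fun m n => (m == n)%:R.

Definition powm (S : pzSemiRingType) (X : nat -> nat -> S) (n : nat) :
    nat -> nat -> S :=
  iter n (mulm X) (idm S).

(* E_[r] = [ I_r 0 0 ... ] *)
Definition Erow (S : pzSemiRingType) (r : nat) : 'I_r -> nat -> S :=
  fun i n => (val i == n)%:R.

(* The triangular inverse of a triangular semi-infinite matrix: for such a
   matrix the (m, n) entry of the inverse of a leading truncation does not
   depend on the size of the truncation. *)
Definition trig_inv (S : comUnitRingType) (X : nat -> nat -> S) :
    nat -> nat -> S :=
  fun m n =>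
    invmx (\matrix_(i < (maxn m n).+1, j < (maxn m n).+1) X i j)
      (inord m) (inord n).

(* Makes the products of T with arbitrary arrays on either side meaningful. *)
Definition locally_finite (S : pzSemiRingType) (T : nat -> nat -> S) : Prop :=
  (forall m, exists N, forall n, (N <= n)%N -> T m n = 0) /\
  (forall n, exists N, forall m, (N <= m)%N -> T m n = 0).

Definition normalized_lower (R : realType) (L : nat -> nat -> R) : Prop :=
  (forall n, L n n = 1) /\
  (forall m n, m != n -> m != n.+1 -> L m n = 0).

Definition normalized_upper (R : realType) (U : nat -> nat -> R) : Prop :=
  (forall n, U n n.+1 = 1) /\
  (forall m n, n != m -> n != m.+1 -> U m n = 0).

Definition positive_lower (R : realType) (L : nat -> nat -> R) : Prop :=
  normalized_lower L /\ (forall n, 0 < L n.+1 n).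

Definition positive_upper (R : realType) (U : nat -> nat -> R) : Prop :=
  normalized_upper U /\ (forall n, 0 < U n n).

(* L_1 ... L_p U_q ... U_1 *)
Definition factor_product (R : realType) (p q : nat)
    (L U : nat -> nat -> nat -> R) : nat -> nat -> R :=
  (\big[@mulm R nat nat nat/idm R]_(a <- iota 1 p) L a) **
  (\big[@mulm R nat nat nat/idm R]_(b <- rev (iota 1 q)) U b).

Definition Kmx (R : realType) (r : nat) : 'M[{poly R}]_r :=
  \matrix_(i, j) if val j == (val i).+1 then 1
                 else if (val j == 0%N) && ((val i).+1 == r) then 'X
                 else 0.

Section signed_measures.
Variable R : realType.
Implicit Types (nu : {charge set R -> \bar R}) (f : {poly R}).

Lemma hahn_exists nu :
  exists PN : set R * set R, hahn_decomposition nu PN.1 PN.2.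
Proof. by have [P [N h]] := Hahn_decomposition nu; exists (P, N). Qed.

(* The Jordan decomposition does not depend on the chosen Hahn decomposition. *)
Definition hahn nu := projT2 (cid (hahn_exists nu)).

Definition integrable_poly nu f : Prop :=
  (jordan_pos (hahn nu)).-integrable [set: R] (fun x => (f.[x])%:E) /\
  (jordan_neg (hahn nu)).-integrable [set: R] (fun x => (f.[x])%:E).

Definition finite_moments nu : Prop := forall n, integrable_poly nu 'X^n.

(* The integral of f with respect to nu. *)
Definition cint nu f : R :=
  \int[jordan_pos (hahn nu)]_x f.[x] - \int[jordan_neg (hahn nu)]_x f.[x].

Definition addc (nu1 nu2 : {charge set R -> \bar R}) :
    {charge set R -> \bar R} :=
  cadd nu1 nu2.

Definition zeroc : {charge set R -> \bar R} := czero.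

Definition oppc nu : {charge set R -> \bar R} := copp nu.

(* The signed measure with density f with respect to nu.  The second case does
   not occur when nu has finite moments. *)
Definition densc f nu : {charge set R -> \bar R} :=
  match pselect (integrable_poly nu f) with
  | left h => addc (induced_charge h.1) (oppc (induced_charge h.2))
  | right _ => zeroc
  end.

End signed_measures.

Definition mxcharge (R : realType) (q p : nat) : Type :=
  'I_q -> 'I_p -> {charge set R -> \bar R}.

(* P(x) dPsi(x) Q(x) *)
Definition mulmxc (R : realType) (q p : nat) (P : 'M[{poly R}]_q)
    (Psi : mxcharge R q p) (Q : 'M[{poly R}]_p) : mxcharge R q p :=
  fun j i => \big[@addc R/zeroc R]_(k < q) \big[@addc R/zeroc R]_(l < p)
               densc (P j k * Q l i) (Psi k l).

Definition christoffel (R : realType) (q p : nat) (Psi : mxcharge R q p)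
    (b a : nat) : mxcharge R q p :=
  mulmxc (Kmx R q ^+ b) Psi (Kmx R p ^+ a)^T.

Definition moment (R : realType) (q p : nat) (Psi : mxcharge R q p)
    (n : nat) : 'M[R]_(q, p) :=
  \matrix_(j, i) cint (Psi j i) 'X^n.

(* The semi-infinite matrix with (q u + j, p v + i) entry F u v j i. *)
Definition stepline (R : realType) (q p : nat) (hq : (0 < q)%N) (hp : (0 < p)%N)
    (F : nat -> nat -> 'M[R]_(q, p)) : nat -> nat -> R :=
  fun r s => F (r %/ q)%N (s %/ p)%N
               (Ordinal (ltn_pmod r hq)) (Ordinal (ltn_pmod s hp)).

Definition moment_matrix (R : realType) (q p : nat) (hq : (0 < q)%N)
    (hp : (0 < p)%N) (Psi : mxcharge R q p) : nat -> nat -> R :=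
  stepline hq hp (fun u v => moment Psi (u + v)).

Definition weakly_normal (R : realType) (q p : nat) (hq : (0 < q)%N)
    (hp : (0 < p)%N) (Psi : mxcharge R q p) : Prop :=
  forall n, \det (\matrix_(r < n, s < n) moment_matrix hq hp Psi r s) != 0.

(* The step-line space at position n = r m + j, as polynomials of size at most
   m + 1 in the components s <= j and at most m in the others. *)
Definition stepline_space (R : realType) (r n : nat) (v : 'I_r -> {poly R}) :
    Prop :=
  forall s : 'I_r,
    (size (v s) <= if (s <= n %% r)%N then (n %/ r).+1 else n %/ r)%N.

Definition biorthogonal (R : realType) (q p : nat) (Psi : mxcharge R q p)
    (B : nat -> 'I_q -> {poly R}) (A : 'I_p -> nat -> {poly R}) : Prop :=
  forall m n,
    \sum_(s < q) \sum_(t < p) cint (Psi s t) (B m s * A t n) = (m == n)%:R.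

(* B and A are the mixed-type multiple orthogonal polynomials of Psi, up to
   the normalization B -> D B, A -> A D^-1 with D diagonal. *)
Definition is_mop (R : realType) (q p : nat) (hq : (0 < q)%N) (hp : (0 < p)%N)
    (Psi : mxcharge R q p)
    (B : nat -> 'I_q -> {poly R}) (A : 'I_p -> nat -> {poly R}) : Prop :=
  [/\ weakly_normal hq hp Psi,
      forall n, stepline_space n (B n),
      forall n, stepline_space n (trm A n) &
      biorthogonal Psi B A].

Definition initial_conditions (R : realType) (q p : nat)
    (B : nat -> 'I_q -> {poly R}) (A : 'I_p -> nat -> {poly R})
    (xi : 'M[R]_q) (nu : 'M[R]_p) : Prop :=
  Erow {poly R} (r := q) ** B = mapm polyC xi /\
  A ** trm (Erow {poly R} (r := p)) = mapm polyC nu^T.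

Definition nonsingular_lower (R : realType) (r : nat) (M : 'M[R]_r) : Prop :=
  is_trig_mx M /\ M \in unitmx.

Definition right_recurrence (R : realType) (q : nat) (T : nat -> nat -> R)
    (B : nat -> 'I_q -> {poly R}) : Prop :=
  mapm polyC T ** B = scalem 'X B.

Definition left_recurrence (R : realType) (p : nat) (T : nat -> nat -> R)
    (A : 'I_p -> nat -> {poly R}) : Prop :=
  A ** mapm polyC T = scalem 'X A.

Definition recurrence_matrix (R : realType) (q p : nat)
    (B : nat -> 'I_q -> {poly R}) (A : 'I_p -> nat -> {poly R})
    (T : nat -> nat -> R) : Prop :=
  [/\ locally_finite T, right_recurrence T B & left_recurrence T A].

(* xi^-1 E_[q] T^n E_[p]^T nu^-T *)
Definition reconstructed_moment (R : realType) (q p : nat)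
    (xi : 'M[R]_q) (nu : 'M[R]_p) (T : nat -> nat -> R) (n : nat) :
    'M[R]_(q, p) :=
  invmx xi
  *m (\matrix_(j, i) (Erow R (r := q) ** powm T n ** trm (Erow R (r := p))) j i)
  *m (invmx nu)^T.

Definition reconstructed_matrix (R : realType) (q p : nat) (hq : (0 < q)%N)
    (hp : (0 < p)%N) (xi : 'M[R]_q) (nu : 'M[R]_p) (T : nat -> nat -> R) :
    nat -> nat -> R :=
  stepline hq hp (fun u v => reconstructed_moment xi nu T (u + v)).

(* L is the normalized column-side connection matrix from the system Psi, B, A
   to its transform Psi' = Psi K_p^T with arrays B', A'. *)
Definition column_connection (R : realType) (q p : nat) (hq : (0 < q)%N)
    (hp : (0 < p)%N)
    (Psi : mxcharge R q p)
    (B : nat -> 'I_q -> {poly R}) (A : 'I_p -> nat -> {poly R})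
    (Psi' : mxcharge R q p)
    (B' : nat -> 'I_q -> {poly R}) (A' : 'I_p -> nat -> {poly R})
    (L : nat -> nat -> R) : Prop :=
  [/\ is_mop hq hp Psi B A, is_mop hq hp Psi' B' A',
      normalized_lower L,
      A ** mapm polyC L = (Kmx R p)^T ** A' &
      mapm polyC L ** B' = B].

(* Same with Psi' = K_q Psi. *)
Definition row_connection (R : realType) (q p : nat) (hq : (0 < q)%N)
    (hp : (0 < p)%N)
    (Psi : mxcharge R q p)
    (B : nat -> 'I_q -> {poly R}) (A : 'I_p -> nat -> {poly R})
    (Psi' : mxcharge R q p)
    (B' : nat -> 'I_q -> {poly R}) (A' : 'I_p -> nat -> {poly R})
    (U : nat -> nat -> R) : Prop :=
  [/\ is_mop hq hp Psi B A, is_mop hq hp Psi' B' A',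
      normalized_upper U,
      mapm polyC U ** B = B' ** Kmx R q &
      A' ** mapm polyC U = A].

(* The arrays along a chain start from B, A and are then normalized by the
   one-step formulas. *)
Definition column_chain (R : realType) (q p : nat) (hq : (0 < q)%N)
    (hp : (0 < p)%N) (Psi : mxcharge R q p)
    (B : nat -> 'I_q -> {poly R}) (A : 'I_p -> nat -> {poly R})
    (L : nat -> nat -> nat -> R) : Prop :=
  exists (Bc : nat -> nat -> 'I_q -> {poly R})
         (Ac : nat -> 'I_p -> nat -> {poly R}),
    [/\ Bc 0%N = B, Ac 0%N = A &
        forall a, (1 <= a <= p)%N ->
          column_connection hq hp
            (christoffel Psi 0 a.-1) (Bc a.-1) (Ac a.-1)
            (christoffel Psi 0 a) (Bc a) (Ac a) (L a)].

Definition row_chain (R : realType) (q p : nat) (hq : (0 < q)%N)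
    (hp : (0 < p)%N) (Psi : mxcharge R q p)
    (B : nat -> 'I_q -> {poly R}) (A : 'I_p -> nat -> {poly R})
    (U : nat -> nat -> nat -> R) : Prop :=
  exists (Bc : nat -> nat -> 'I_q -> {poly R})
         (Ac : nat -> 'I_p -> nat -> {poly R}),
    [/\ Bc 0%N = B, Ac 0%N = A &
        forall b, (1 <= b <= q)%N ->
          row_connection hq hp
            (christoffel Psi b.-1 0) (Bc b.-1) (Ac b.-1)
            (christoffel Psi b 0) (Bc b) (Ac b) (U b)].

(* LL b a sits on the edge (b, a) -> (b, a + 1) and UU b a on the edge
   (b - 1, a) -> (b, a). *)
Definition edge_matrices (R : realType) (q p : nat)
    (L U : nat -> nat -> nat -> R)
    (LL UU : nat -> nat -> nat -> nat -> R) : Prop :=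
  [/\ forall b a, (b <= q)%N -> (a < p)%N -> positive_lower (LL b a),
      forall b a, (1 <= b <= q)%N -> (a <= p)%N -> positive_upper (UU b a),
      forall b, (1 <= b <= q)%N -> UU b 0%N = U b,
      forall a, (a < p)%N -> LL 0%N a = L a.+1 &
      forall b a, (1 <= b <= q)%N -> (a < p)%N ->
        UU b a ** LL b.-1 a = LL b a ** UU b a.+1].

(* Transport divides by the matrices K, so it acts on arrays of rational
   functions. *)
Section transport.
Variables (R : realType) (q p : nat).

Definition arrays : Type :=
  ((nat -> 'I_q -> {fraction {poly R}}) *
   ('I_p -> nat -> {fraction {poly R}}))%type.

Definition ratc (c : R) : {fraction {poly R}} := tofrac c%:P.

Definition Kfrac (r : nat) : 'M[{fraction {poly R}}]_r :=
  map_mx (@tofrac {poly R}) (Kmx R r).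

Definition to_arrays (B : nat -> 'I_q -> {poly R})
    (A : 'I_p -> nat -> {poly R}) : arrays :=
  (mapm (@tofrac {poly R}) B, mapm (@tofrac {poly R}) A).

Definition column_step (L : nat -> nat -> R) (BA : arrays) : arrays :=
  (mapm ratc (trig_inv L) ** BA.1,
   invmx (Kfrac p)^T ** (BA.2 ** mapm ratc L)).

Definition row_step (U : nat -> nat -> R) (BA : arrays) : arrays :=
  (mapm ratc U ** BA.1 ** invmx (Kfrac q),
   BA.2 ** mapm ratc (trig_inv U)).

(* A path is the list of its edges, true for (b, a) -> (b + 1, a) and false for
   (b, a) -> (b, a + 1); (b, a) is the current vertex. *)
Fixpoint transport_from (LL UU : nat -> nat -> nat -> nat -> R) (b a : nat)
    (path : seq bool) (BA : arrays) : arrays :=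
  match path with
  | [::] => BA
  | true :: path' => transport_from LL UU b.+1 a path' (row_step (UU b.+1 a) BA)
  | false :: path' => transport_from LL UU b a.+1 path' (column_step (LL b a) BA)
  end.

Definition transport LL UU (path : seq bool) (BA : arrays) : arrays :=
  transport_from LL UU 0 0 path BA.

Definition path_to (b a : nat) (path : seq bool) : Prop :=
  count_mem true path = b /\ count_mem false path = a.

End transport.

(* Main.v *)
From HB Require Import structures.
Require Import Defs.
From mathcomp Require Import all_boot all_order all_algebra.
From mathcomp Require Import all_classical all_reals all_analysis.
From mathcomp Require Import perm measurable_realfun.

Set Implicit Arguments.
Unset Strict Implicit.
Unset Printing Implicit Defensive.

Import Order.TTheory GRing.Theory Num.Theory.
Import numFieldNormedType.Exports.

Local Open Scope classical_set_scope.
Local Open Scope ring_scope.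

(** Write the coefficients of an array of polynomials as one semi-infinite
    matrix, ordered along the step-line: the entry (n, q u + j) of S is the
    coefficient of x^u in component j of the n-th row of B, and G encodes the
    transpose of A in the same way.  The degree conditions say that S and G are
    lower triangular, and biorthogonality says S M G^T = I, where M is the
    moment matrix: S and G are the factors of a Gauss-Borel (triangular)
    factorization of M.  In this encoding multiplying B by K_q on the right
    shifts the columns of S by one, and multiplying by x shifts them by q.
    Hence K_q^b dPsi (K_p^a)^T has the moment matrix [M_(r+b,s+a)], and M has
    the Hankel symmetry M_(r+q,s) = M_(r,s+p).

    Let N be the shift.  A column connection L from (S, G) to (S', G') now
    reads L S' = S and G' N = L^T G.  A row connection U is the same relation
    with L replaced by U^T and the roles of S and G exchanged, so one argument
    serves both directions.  A connection carries a Gauss-Borel factorization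
    of M to one of M without its first column, because
    S' (M N^T) G'^T = L^-1 S M G^T L = I; minors, step-line degrees and
    biorthogonality of the target follow from the triangular factorization
    alone (edge_gauss_borel, system_is_mop).

    The heart is a single square U L = L' U' whose edges out of one corner are
    a column connection L and a row connection U.  From (U')^T (L')^T = L^T U^T
    one gets (L')^T G1 = (U'^T)^-1 G2 N, where G1 and G2 are the factors at the
    two neighbouring corners: the right-hand side has a zero first column, so
    K_p divides on the opposite edge too, and both ways round the square give
    the same arrays (complete_square).  The two chains supply two sides of the
    rectangle, and induction fills it (rectangle_edges).  Connections are
    exactly the transport relations, since K_r is invertible over the rational
    functions (column_step_edge, row_step_edge); this gives path independence.

    At one vertex the recurrence matrix is T = S N^q S^-1 = S N^q M G^T, and
    T^n = S N^(q n) M G^T.  As S and G are triangular, the corner of T^n is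
    xi times the n-th matrix moment times nu^T, which reconstructs the
    moments.  An array C with T C = x C and the initial rows of B satisfies
    S^-1 C = I by recursion, which is uniqueness (recurrence_uniq).

    On the side of measure theory, integrals against a charge are defined by
    its Jordan decomposition, which does not commute with sums and densities.
    However, whenever a charge is a difference m1 - m2 of finite measures, its
    integrals are differences of integrals for m1 and m2
    (signed_integral_difference), and this computes the moments of
    P dPsi Q (has_cint_mulmxc). *)

(** * Products of row-finite matrices *)

Section mulm_finite.

Lemma mulm_fin (S : pzSemiRingType) (I J : Type) (K : finType)
    (X : I -> K -> S) (Y : K -> J -> S) i j :
  (X ** Y) i j = \sum_(k : K) X i k * Y k j.
Proof.
rewrite /mulm (fsbigE (enum K)) ?enum_uniq//.
  by rewrite big_enum_cond; apply: eq_bigl => k; rewrite in_setT.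
by move=> k _; rewrite mem_enum.
Qed.

Variables (S : comPzSemiRingType).

(** Every infinite product below is computed through this lemma, with a bound
    on the support of its terms. *)
Lemma mulm_bound (I J : Type) (X : I -> nat -> S) (Y : nat -> J -> S) i j N :
    (forall k, (N <= k)%N -> X i k * Y k j = 0) ->
  (X ** Y) i j = \sum_(k < N) X i k * Y k j.
Proof.
move=> h; rewrite -(big_mkord xpredT (fun k => X i k * Y k j)).
rewrite /mulm (fsbigE (index_iota 0 N)) ?iota_uniq//.
  by apply: eq_bigl => k; rewrite in_setT.
by move=> k _; rewrite mem_index_iota/= -leqNgt => /h.
Qed.

Definition row_finite (I : Type) (X : I -> nat -> S) : Prop :=
  forall i, exists N, forall k, (N <= k)%N -> X i k = 0.

Definition col_finite (J : Type) (X : nat -> J -> S) : Prop :=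
  row_finite (trm X).

Lemma trm_mulm (I J : Type) (K : choiceType) (X : I -> K -> S) (Y : K -> J -> S) :
  trm (X ** Y) = trm Y ** trm X.
Proof.
by apply/funext => j; apply/funext => i; apply: eq_fsbigr => k _; rewrite mulrC.
Qed.

Lemma trmK (I J : Type) (X : I -> J -> S) : trm (trm X) = X.
Proof. by []. Qed.

(** Associativity fails for infinite matrices in general; it holds when the
    double sum that computes an entry has finite support.  Row- or
    column-finiteness of two of the factors ensures this in the cases below. *)
Lemma mulmA_bound (I J : Type) (X : I -> nat -> S) (Y : nat -> nat -> S)
    (Z : nat -> J -> S) i j N M :
    (forall k, (N <= k)%N -> X i k = 0) ->
    (forall k l, (k < N)%N -> (M <= l)%N -> Y k l * Z l j = 0) ->
  (X ** (Y ** Z)) i j = ((X ** Y) ** Z) i j.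
Proof.
move=> hX hYZ; rewrite (mulm_bound (N := N)); last first.
  by move=> k /hX ->; rewrite mul0r.
have XYE l : (X ** Y) i l = \sum_(k < N) X i k * Y k l.
  by apply: mulm_bound => k /hX ->; rewrite mul0r.
rewrite [RHS](mulm_bound (N := M)); last first.
  move=> l lM; rewrite XYE mulr_suml big1// => k _.
  by rewrite -mulrA hYZ ?mulr0.
under [RHS]eq_bigr do rewrite XYE mulr_suml.
rewrite exchange_big /=; apply: eq_bigr => k _.
rewrite (mulm_bound (N := M)); last by move=> l lM; exact: hYZ.
by rewrite mulr_sumr; apply: eq_bigr => l _; rewrite mulrA.
Qed.

Lemma mulmA_rr (I J : Type) (X : I -> nat -> S) (Y : nat -> nat -> S)
    (Z : nat -> J -> S) :
  row_finite X -> row_finite Y -> X ** (Y ** Z) = X ** Y ** Z.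
Proof.
move=> fX fY; apply/funext => i; apply/funext => j.
have [N hN] := fX i; have [m hm] := choice fY.
apply: (mulmA_bound (N := N) (M := \max_(k < N) m k)) => // k l kN ml.
rewrite hm ?mul0r//; apply: leq_trans ml.
exact: (leq_bigmax (Ordinal kN)).
Qed.

Lemma mulmA_rc (I J : Type) (X : I -> nat -> S) (Y : nat -> nat -> S)
    (Z : nat -> J -> S) :
  row_finite X -> col_finite Z -> X ** (Y ** Z) = X ** Y ** Z.
Proof.
move=> fX fZ; apply/funext => i; apply/funext => j.
have [N hN] := fX i; have [M hM] := fZ j.
apply: (mulmA_bound (N := N) (M := M)) => // k l _ /hM.
by rewrite /trm => ->; rewrite mulr0.
Qed.

Lemma mulmA_cc (I J : Type) (X : I -> nat -> S) (Y : nat -> nat -> S)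
    (Z : nat -> J -> S) :
  col_finite Y -> col_finite Z -> X ** (Y ** Z) = X ** Y ** Z.
Proof.
move=> fY fZ; rewrite -[LHS]trmK -[RHS]trmK; congr trm.
by rewrite !trm_mulm mulmA_rr.
Qed.

Lemma row_finite_mulm (I : Type) (X : I -> nat -> S) (Y : nat -> nat -> S) :
  row_finite X -> row_finite Y -> row_finite (X ** Y).
Proof.
move=> fX fY i; have [N hN] := fX i; have [m hm] := choice fY.
exists (\max_(k < N) m k) => l ml.
rewrite (mulm_bound (N := N)); last by move=> k /hN ->; rewrite mul0r.
rewrite big1// => k _; rewrite hm ?mulr0//; apply: leq_trans ml.
exact: (leq_bigmax k).
Qed.

Definition lower (X : nat -> nat -> S) : Prop :=
  forall m n, (m < n)%N -> X m n = 0.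

Lemma lower_row_finite X : lower X -> row_finite X.
Proof. by move=> lX i; exists i.+1; exact: lX. Qed.

Lemma lower_mulmE X (J : Type) (Y : nat -> J -> S) m j :
  lower X -> (X ** Y) m j = \sum_(k < m.+1) X m k * Y k j.
Proof. by move=> lX; apply: mulm_bound => k mk; rewrite lX ?mul0r. Qed.

Lemma lower_mulm X Y : lower X -> lower Y -> lower (X ** Y).
Proof.
move=> lX lY m n mn; rewrite lower_mulmE// big1// => k _.
by rewrite lY ?mulr0//; apply: leq_trans mn.
Qed.

Lemma lower_idm : lower (idm S).
Proof. by move=> m n mn; rewrite /idm ltn_eqF. Qed.

Lemma mul1m (J : Type) (X : nat -> J -> S) : idm S ** X = X.
Proof.
apply/funext => m; apply/funext => j; rewrite lower_mulmE; last exact: lower_idm.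
rewrite (bigD1 ord_max)//= /idm eqxx mul1r big1 ?addr0// => k kmax.
by rewrite gtn_eqF ?mul0r// ltn_neqAle -ltnS ltn_ord andbT.
Qed.

Lemma trm_idm : trm (idm S) = idm S.
Proof. by apply/funext => m; apply/funext => n; rewrite /trm /idm eq_sym. Qed.

Lemma mulm1 (I : Type) (X : I -> nat -> S) : X ** idm S = X.
Proof. by rewrite -[LHS]trmK trm_mulm trm_idm mul1m. Qed.

(** Products with a power of the shift matrix: padcols k X is X N^k, dropcols k X
    is X (N^T)^k and droprows k X is N^k X.  As functions on indices they commute
    with products on the other side without any finiteness condition. *)
Definition padcols (I : Type) k (X : I -> nat -> S) : I -> nat -> S :=
  fun i s => if (s < k)%N then 0 else X i (s - k)%N.

Definition dropcols (I : Type) k (X : I -> nat -> S) : I -> nat -> S :=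
  fun i s => X i (s + k)%N.

Definition droprows (J : Type) k (X : nat -> J -> S) : nat -> J -> S :=
  fun r j => X (r + k)%N j.

Lemma padcolsK (I : Type) k (X : I -> nat -> S) : dropcols k (padcols k X) = X.
Proof.
apply/funext => i; apply/funext => s.
by rewrite /dropcols /padcols ltnNge leq_addl addnK.
Qed.

Lemma mulm_padcols (I : Type) (K : choiceType) k (X : I -> K -> S)
    (Y : K -> nat -> S) : X ** padcols k Y = padcols k (X ** Y).
Proof.
apply/funext => i; apply/funext => s; rewrite /padcols; case: ltnP => sk.
  by rewrite /mulm sk fsbig1// => l _; rewrite mulr0.
by rewrite /mulm ltnNge sk.
Qed.

Lemma padcols_mulm (I J : Type) k (X : I -> nat -> S) (Y : nat -> J -> S) :
  row_finite X -> padcols k X ** Y = X ** droprows k Y.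
Proof.
move=> fX; apply/funext => i; apply/funext => j; have [N hN] := fX i.
rewrite [RHS](mulm_bound (N := N)); last by move=> l /hN ->; rewrite mul0r.
rewrite (mulm_bound (N := k + N)%N); last first.
  move=> l kNl; rewrite /padcols; case: ifP => _; first by rewrite mul0r.
  by rewrite hN ?mul0r// leq_subRL// (leq_trans _ kNl)// leq_addr.
rewrite big_split_ord /= big1 ?add0r => [|l _]; last by rewrite /padcols ltn_ord mul0r.
apply: eq_bigr => l _; rewrite /padcols /droprows /=.
by rewrite ltnNge leq_addr/= addKn addnC.
Qed.

Lemma row_finite_padcols (I : Type) k (X : I -> nat -> S) :
  row_finite X -> row_finite (padcols k X).
Proof.
move=> fX i; have [N hN] := fX i; exists (k + N)%N => l kNl.
rewrite /padcols; case: ifP => // _; apply: hN.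
by rewrite leq_subRL// (leq_trans _ kNl)// leq_addr.
Qed.

End mulm_finite.

Section triangular_inverse.
Variable F : fieldType.
Implicit Types X Y : nat -> nat -> F.

Definition truncmx X n : 'M[F]_n := \matrix_(i < n, j < n) X i j.

Lemma truncmx_mulm X Y n : lower X ->
  truncmx (X ** Y) n = truncmx X n *m truncmx Y n.
Proof.
move=> lX; apply/matrixP => i j; rewrite !mxE (mulm_bound (N := n)); last first.
  by move=> k nk; rewrite lX ?mul0r// (leq_trans (ltn_ord i)).
by apply: eq_bigr => k _; rewrite !mxE.
Qed.

Lemma truncmx_idm n : truncmx (idm F) n = 1%:M.
Proof. by apply/matrixP => i j; rewrite !mxE. Qed.

Lemma truncmx_unit X n : lower X -> (forall k, X k k != 0) ->
  truncmx X n \in unitmx.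
Proof.
move=> lX X0; rewrite unitmxE det_trig.
  by rewrite unitfE; apply/prodf_neq0 => i _; rewrite mxE.
by apply/is_trig_mxP => i j ij; rewrite mxE lX.
Qed.

Section trig_inv.
Variable X : nat -> nat -> F.
Hypotheses (lX : lower X) (X0 : forall k, X k k != 0).

(** The inverse of a large truncation restricts to the inverse of a smaller
    one, because the factor is triangular. *)
Lemma trig_invE n (i j : 'I_n) : trig_inv X i j = invmx (truncmx X n) i j.
Proof.
rewrite /trig_inv; set n0 := (maxn i j).+1.
have le_n0 : (n0 <= n)%N by rewrite /n0 gtn_max !ltn_ord.
pose w := widen_ord le_n0.
pose Z : 'M[F]_n0 := \matrix_(k, l) invmx (truncmx X n) (w k) (w l).
have XZ : truncmx X n0 *m Z = 1%:M.
  apply/matrixP => k l.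
  have := congr1 (fun M : 'M[F]_n => M (w k) (w l)) (mulmxV (truncmx_unit n lX X0)).
  rewrite !mxE -[in RHS]val_eqE /= => <-.
  rewrite [RHS](bigID (fun t : 'I_n => (t < n0)%N))/= [X in _ + X]big1 ?addr0.
    rewrite (big_ord_narrow le_n0); apply: eq_bigr => t _; rewrite !mxE.
    by congr (_ * invmx _ _ _); apply: val_inj.
  move=> t; rewrite -leqNgt mxE => n0t.
  by rewrite lX ?mul0r//= (leq_trans (ltn_ord k)).
have ZE : invmx (truncmx X n0) = Z.
  by rewrite -[LHS]mulmx1 -XZ mulKmx// truncmx_unit.
rewrite -/(truncmx X n0) ZE mxE; congr (invmx _ _ _); apply: val_inj;
  by rewrite /= inordK// /n0 ltnS ?leq_maxl ?leq_maxr.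
Qed.

Lemma mulm_trig_inv : X ** trig_inv X = idm F.
Proof.
apply/funext => m; apply/funext => n; pose N := (maxn m n).+1.
have hm : (m < N)%N by rewrite ltnS leq_maxl.
have hn : (n < N)%N by rewrite ltnS leq_maxr.
have := congr1 (fun M : 'M[F]_N => M (Ordinal hm) (Ordinal hn))
  (mulmxV (truncmx_unit N lX X0)).
rewrite !mxE -[in RHS]val_eqE /= /idm => <-.
rewrite (mulm_bound (N := N)); last first.
  by move=> k Nk; rewrite lX ?mul0r// (leq_trans hm).
by apply: eq_bigr => k _; rewrite mxE (trig_invE k (Ordinal hn)).
Qed.

Lemma lower_trig_inv : lower (trig_inv X).
Proof.
elim/ltn_ind => m IH n mn.
have /eqP := congr1 (fun Z => Z m n) mulm_trig_inv.
rewrite lower_mulmE// big_ord_recr/= big1 ?add0r => [|k _]; last first.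
  by rewrite IH ?mulr0//; apply: ltn_trans mn.
by rewrite /idm (ltn_eqF mn) mulf_eq0 (negPf (X0 m)) => /eqP.
Qed.

Lemma trig_inv_diag k : trig_inv X k k != 0.
Proof.
have := congr1 (fun Z => Z k k) mulm_trig_inv.
rewrite lower_mulmE// big_ord_recr/= big1 ?add0r => [|l _]; last first.
  by rewrite lower_trig_inv ?mulr0.
rewrite /idm eqxx => h; apply/eqP => z.
by move: h; rewrite z mulr0 => /esym/eqP; rewrite oner_eq0.
Qed.

End trig_inv.

(** A right inverse that is again triangular has itself a right inverse, which
    must then be X. *)
Lemma trig_inv_mulm X : lower X -> (forall k, X k k != 0) ->
  trig_inv X ** X = idm F.
Proof.
move=> lX X0; have lY := lower_trig_inv lX X0.
have Y0 := trig_inv_diag lX X0.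
have XE : X = trig_inv (trig_inv X).
  rewrite -[LHS]mulm1 -(mulm_trig_inv lY Y0) mulmA_rr; last first.
  - exact: lower_row_finite.
  - exact: lower_row_finite.
  by rewrite mulm_trig_inv// mul1m.
by rewrite {2}XE mulm_trig_inv.
Qed.

Lemma trig_inv_trm X : trig_inv (trm X) = trm (trig_inv X).
Proof.
apply/funext => m; apply/funext => n; rewrite /trm /trig_inv maxnC.
rewrite (_ : \matrix_(_, _) _ = (\matrix_(i, j) X i j)^T).
  by rewrite -trmx_inv mxE.
by apply/matrixP => i j; rewrite !mxE.
Qed.

End triangular_inverse.

(** * Gauss-Borel factorizations and their edges *)

Section gauss_borel.
Variable F : fieldType.
Implicit Types M S G V T X : nat -> nat -> F.

Lemma mulm_trm_padcols k M G : row_finite G ->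
  M ** trm (padcols k G) = dropcols k M ** trm G.
Proof.
move=> fG; have /(congr1 (@trm _ _ _)) := padcols_mulm k (trm M) fG.
by rewrite !trm_mulm.
Qed.

(** M = S^-1 (G^T)^-1 with triangular factors, stated without inverses so that it
    is literally the biorthogonality of two arrays. *)
Record gauss_borel M S G : Prop := GaussBorel {
  gb_lowerl : lower S;
  gb_lowerr : lower G;
  gb_biorth : S ** M ** trm G = idm F
}.

Lemma trm_triple M S G : row_finite S -> row_finite G ->
  trm (S ** M ** trm G) = G ** trm M ** trm S.
Proof. by move=> fS fG; rewrite !trm_mulm trmK mulmA_rc. Qed.

(** The duality that exchanges the two arrays of a system. *)
Lemma gauss_borel_trm M S G : gauss_borel M S G -> gauss_borel (trm M) G S.
Proof.
move=> [lS lG bi]; split=> //; rewrite -trm_triple ?bi ?trm_idm//;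
  exact: lower_row_finite.
Qed.

Lemma gauss_borel_truncmx M S G n : gauss_borel M S G ->
  truncmx S n *m truncmx M n *m (truncmx G n)^T = 1%:M.
Proof.
move=> [lS lG bi]; rewrite -truncmx_idm -bi.
apply/matrixP => i j; rewrite !mxE (mulm_bound (N := n)); last first.
  by move=> k nk; rewrite /trm lG ?mulr0// (leq_trans (ltn_ord j)).
by apply: eq_bigr => k _; rewrite -truncmx_mulm// !mxE.
Qed.

Lemma gauss_borel_minor M S G n : gauss_borel M S G -> \det (truncmx M n) != 0.
Proof.
move=> /(gauss_borel_truncmx n) h; rewrite -unitfE -unitmxE.
have /mulmx1_unit[+ _] := h.
by rewrite unitmx_mul => /andP[].
Qed.

Lemma gauss_borel_diag M S G k : gauss_borel M S G -> S k k != 0.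
Proof.
move=> gb; have /mulmx1_unit[+ _] := gauss_borel_truncmx k.+1 gb.
rewrite unitmx_mul => /andP[+ _]; rewrite unitmxE det_trig.
  by rewrite unitfE => /prodf_neq0 /(_ ord_max isT); rewrite mxE.
by apply/is_trig_mxP => i j ij; rewrite mxE (gb_lowerl gb).
Qed.

(** M need not be row finite, so the product M G^T cannot be rearranged by
    associativity; it is S^-1 because it is a right inverse of the triangular S. *)
Lemma gauss_borel_inv M S G : gauss_borel M S G -> M ** trm G = trig_inv S.
Proof.
move=> gb; have S0 k := gauss_borel_diag k gb.
case: (gb) => lS lG bi; have lY := lower_trig_inv lS S0.
rewrite -[LHS]mul1m -(trig_inv_mulm lS S0) -mulmA_rr; last first.
- exact: lower_row_finite.
- exact: lower_row_finite.
by rewrite (mulmA_rc M (lower_row_finite lS)) ?bi ?mulm1//; exact: lower_row_finite.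
Qed.

Section edges.

(** A column connection V from the factors s = (S, G) to s' = (S', G'), namely
    V S' = S and G' N = V^T G.  Row connections are obtained by exchanging the
    factors, with V the transpose of U. *)
Definition edge V (s s' : (nat -> nat -> F) * (nat -> nat -> F)) : Prop :=
  V ** s'.1 = s.1 /\ padcols 1 s'.2 = trm V ** s.2.

Definition edge_target V (s : (nat -> nat -> F) * (nat -> nat -> F)) :=
  (trig_inv V ** s.1, dropcols 1 (trm V ** s.2)).

Definition swap_sides (s : (nat -> nat -> F) * (nat -> nat -> F)) := (s.2, s.1).

Lemma swap_sidesK s : swap_sides (swap_sides s) = s.
Proof. by case: s. Qed.

(** The common form of normalized lower matrices and of transposes of positive
    upper ones: a nonzero diagonal is what makes V invertible. *)
Record lower_bidiagonal V : Prop := LowerBidiagonal {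
  lb_diag : forall k, V k k != 0;
  lb_band : forall m n, m != n -> m != n.+1 -> V m n = 0
}.

Lemma lower_bidiagonal_lower V : lower_bidiagonal V -> lower V.
Proof.
move=> bV m n mn; rewrite (lb_band bV)// neq_ltn ?mn// ltnS ltnW//.
Qed.

Lemma lower_bidiagonal_col V : lower_bidiagonal V -> row_finite (trm V).
Proof.
move=> bV n; exists n.+2 => m nm; rewrite /trm (lb_band bV)// neq_ltn.
  by rewrite (ltnW nm) orbT.
by rewrite nm orbT.
Qed.

(** The target of an edge is determined by its source, since shifting columns
    and multiplying by an invertible V are injective. *)
Lemma edge_step V s s' : lower_bidiagonal V -> edge V s s' -> s' = edge_target V s.
Proof.
move=> bV [e1 e2]; have lV := lower_bidiagonal_lower bV.
have lVi := lower_trig_inv lV (lb_diag bV).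
rewrite [s']surjective_pairing /edge_target -e1 -e2 padcolsK mulmA_rr.
- by rewrite (trig_inv_mulm lV (lb_diag bV)) mul1m.
- exact: lower_row_finite.
- exact: lower_row_finite.
Qed.

(** S' (M N^T) G'^T = S' M (G' N)^T = V^-1 S M G^T V = I. *)
Lemma edge_gauss_borel M V s s' : lower_bidiagonal V -> edge V s s' ->
  gauss_borel M s.1 s.2 -> gauss_borel (dropcols 1 M) s'.1 s'.2.
Proof.
move=> bV e gb; have lV := lower_bidiagonal_lower bV.
have lVi := lower_trig_inv lV (lb_diag bV).
have S0 k := gauss_borel_diag k gb; have invS := gauss_borel_inv gb.
case: (gb) => lS lG _; have lSi := lower_trig_inv lS S0.
have lG' : lower s'.2.
  rewrite (edge_step bV e) /= => m n mn; rewrite /dropcols.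
  rewrite (mulm_bound (N := m.+2)) => [|k mk]; last first.
    rewrite /trm (lb_band bV) ?mul0r// neq_ltn ?mk ?(ltnW mk) ?orbT//.
  apply: big1 => k _; rewrite lG ?mulr0// addn1.
  by rewrite ltnS (leq_trans _ mn)// -ltnS.
have padG : dropcols 1 M ** trm s'.2 = trig_inv s.1 ** V.
  rewrite -invS -mulm_trm_padcols; last exact: lower_row_finite.
  rewrite e.2 trm_mulm trmK mulmA_cc//; first exact: lower_row_finite.
  exact: lower_bidiagonal_col.
split=> //.
  by rewrite (edge_step bV e); exact: lower_mulm.
rewrite -mulmA_rc; last 2 first.
- by apply: lower_row_finite; rewrite (edge_step bV e); exact: lower_mulm.
- exact: lower_row_finite.
rewrite padG (edge_step bV e) /= -mulmA_rr; last 2 first.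
- exact: lower_row_finite.
- exact: lower_row_finite.
rewrite (mulmA_rr _ (lower_row_finite lS) (lower_row_finite lSi)).
by rewrite (mulm_trig_inv lS S0) mul1m (trig_inv_mulm lV (lb_diag bV)).
Qed.

(** The fourth corner of a square.  The point is that V'^T G1 has a zero first
    column, i.e. that division by K is possible on the edge opposite to V; it
    holds because V'^T G1 = (U'^T)^-1 V^T G, where V^T G already has one.  The
    same computation identifies the row edge. *)
Lemma complete_square V V' U U' s s1 s2 :
    lower_bidiagonal V -> lower_bidiagonal V' ->
    lower_bidiagonal (trm U) -> lower_bidiagonal (trm U') ->
    U ** V = V' ** U' ->
    edge V s s2 -> edge (trm U) (swap_sides s) (swap_sides s1) ->
  edge V' s1 (edge_target V' s1) /\
  edge (trm U') (swap_sides s2) (swap_sides (edge_target V' s1)).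
Proof.
move=> bV bV' bU bU' UV [e1 e2] [f1 f2].
have {}f1 : trm U ** s1.2 = s.2 := f1.
have {}f2 : padcols 1 s1.1 = U ** s.1 := f2.
have lV := lower_bidiagonal_lower bV.
have lV' := lower_bidiagonal_lower bV'.
have lU := lower_bidiagonal_lower bU.
have lU' := lower_bidiagonal_lower bU'.
have lV'i := lower_trig_inv lV' (lb_diag bV').
have lU'i := lower_trig_inv lU' (lb_diag bU').
have V'i := trig_inv_mulm lV' (lb_diag bV').
have U'i := trig_inv_mulm lU' (lb_diag bU').
have rU : row_finite U := lower_bidiagonal_col bU.
have rU' : row_finite U' := lower_bidiagonal_col bU'.
have rV := lower_bidiagonal_col bV; have rV' := lower_bidiagonal_col bV'.
have UVt : trm U' ** trm V' = trm V ** trm U.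
  by rewrite -(trm_mulm V' U') -(trm_mulm U V) UV.
(* multiplying by U'^T on the left turns both sides into V^T G *)
have G3E : trm V' ** s1.2 = padcols 1 (trig_inv (trm U') ** s2.2).
  rewrite -mulm_padcols e2 -f1 (mulmA_rr _ rV (lower_row_finite lU)) -UVt.
  rewrite -(mulmA_rr _ (lower_row_finite lU') rV').
  rewrite (mulmA_rr _ (lower_row_finite lU'i) (lower_row_finite lU')).
  by rewrite U'i mul1m.
(* multiplying by V' on the left turns both sides into U S *)
have S3E : padcols 1 (trig_inv V' ** s1.1) = U' ** s2.1.
  rewrite -mulm_padcols f2 -e1 (mulmA_rr _ rU (lower_row_finite lV)) UV.
  rewrite -(mulmA_rr _ (lower_row_finite lV') rU').
  rewrite (mulmA_rr _ (lower_row_finite lV'i) (lower_row_finite lV')).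
  by rewrite V'i mul1m.
rewrite /edge /edge_target /swap_sides /=; split; split=> //.
- rewrite (mulmA_rr _ (lower_row_finite lV') (lower_row_finite lV'i)).
  by rewrite (mulm_trig_inv lV' (lb_diag bV')) mul1m.
- by rewrite G3E padcolsK.
- rewrite G3E padcolsK.
  rewrite (mulmA_rr _ (lower_row_finite lU') (lower_row_finite lU'i)).
  by rewrite (mulm_trig_inv lU' (lb_diag bU')) mul1m.
Qed.

End edges.

Section recurrence.
Variables (p q : nat) (M S G : nat -> nat -> F).
Hypothesis gb : gauss_borel M S G.
Hypothesis hankel : forall r s, M (r + q)%N s = M r (s + p)%N.

Let lS := gb_lowerl gb.
Let lG := gb_lowerr gb.
Let S0 k := gauss_borel_diag k gb.
Let lSi := lower_trig_inv lS S0.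

(** S N^(q n) M G^T, which is the n-th power of the recurrence matrix. *)
Definition recmx n := S ** droprows (q * n) M ** trm G.

Lemma row_finite_droprows k X : row_finite X -> row_finite (droprows k X).
Proof. by move=> fX r; exact: fX. Qed.

Lemma recmxE n : recmx n = padcols (q * n) S ** trig_inv S.
Proof.
rewrite padcols_mulm; last exact: lower_row_finite.
rewrite -(gauss_borel_inv gb) /recmx -mulmA_rc//; exact: lower_row_finite.
Qed.

Lemma recmx_row_finite : row_finite (recmx 1).
Proof.
rewrite recmxE; apply: row_finite_mulm; last exact: lower_row_finite.
exact/row_finite_padcols/lower_row_finite.
Qed.

Lemma recmx_mulS : recmx 1 ** S = padcols q S.
Proof.
rewrite recmxE muln1 -mulmA_rr; last 2 first.
- exact/row_finite_padcols/lower_row_finite.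
- exact: lower_row_finite.
by rewrite (trig_inv_mulm lS S0) mulm1.
Qed.

Lemma recmx_uniq T : row_finite T -> T ** S = padcols q S -> T = recmx 1.
Proof.
move=> fT TS; rewrite recmxE muln1 -TS -mulmA_rr//; last exact: lower_row_finite.
by rewrite (mulm_trig_inv lS S0) mulm1.
Qed.

Lemma powm_recmx n : powm (recmx 1) n = recmx n.
Proof.
elim: n => [|n IH].
  rewrite /powm /= /recmx muln0 -(gb_biorth gb); congr (_ ** _ ** _).
  by apply/funext => r; rewrite /droprows addn0.
rewrite /powm iterS -/(powm _ n) IH {2}/recmx.
rewrite -(mulmA_rc _ (lower_row_finite lS)); last exact: lower_row_finite.
rewrite (mulmA_rr _ recmx_row_finite); last exact: lower_row_finite.
rewrite recmx_mulS padcols_mulm; last exact: lower_row_finite.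
rewrite /recmx -(mulmA_rc _ (lower_row_finite lS)); last exact: lower_row_finite.
congr (_ ** _).
rewrite (_ : droprows q _ = droprows q (droprows (q * n) M) ** trm G)//.
by congr (_ ** _); apply/funext => r; rewrite /droprows mulnS addnA addnAC.
Qed.

(** D = S^-1 C satisfies N^q D = D N^q, the recurrence of the identity matrix,
    and has its first q rows, so that D = I. *)
Lemma recurrence_uniq (C : nat -> nat -> F) : (0 < q)%N ->
    recmx 1 ** C = padcols q C ->
    (forall n s, (n < q)%N -> C n s = S n s) ->
  C = S.
Proof.
move=> q0 TC C0; pose D := trig_inv S ** C.
have CE : C = S ** D.
  rewrite /D mulmA_rr ?(mulm_trig_inv lS S0) ?mul1m//; exact: lower_row_finite.
suff DE : D = idm F by rewrite CE DE mulm1.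
have Dq : droprows q D = padcols q D.
  rewrite /D -mulm_padcols -TC recmxE muln1 padcols_mulm; last exact: lower_row_finite.
  rewrite -(mulmA_rr _ (lower_row_finite lS)); last first.
    exact/row_finite_droprows/lower_row_finite.
  rewrite (mulmA_rr _ (lower_row_finite lSi) (lower_row_finite lS)).
  by rewrite (trig_inv_mulm lS S0) mul1m.
apply/funext => n; elim/ltn_ind: n => n IH; case: (ltnP n q) => [nq|qn].
  apply/funext => s; rewrite -(trig_inv_mulm lS S0) /D !(lower_mulmE _ _ _ lSi).
  apply: eq_bigr => k _; rewrite C0//; apply: leq_ltn_trans nq.
  by rewrite -ltnS.
apply/funext => s; have := congr1 (fun Z => Z (n - q)%N s) Dq.
rewrite /droprows subnK// => ->; rewrite /padcols IH; last first.
  by rewrite ltn_subrL q0 (leq_trans q0).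
rewrite /idm; case: ltnP => [sq|qs].
  by rewrite gtn_eqF// (leq_trans sq).
by rewrite -(eqn_add2r q) !subnK.
Qed.

(** The Hankel symmetry makes the construction self-dual: the same T serves as
    recurrence matrix for the other array, with p in place of q. *)
Lemma recmx_trm : trm (recmx 1) = G ** droprows (p * 1) (trm M) ** trm S.
Proof.
rewrite /recmx trm_triple; last 2 first.
- exact: lower_row_finite.
- exact: lower_row_finite.
congr (_ ** _ ** _); apply/funext => s; apply/funext => r.
by rewrite /trm /droprows !muln1 hankel.
Qed.

End recurrence.

End gauss_borel.

(** * Filling the rectangle from two of its sides *)

Section rectangle.
Variables (F : fieldType) (p q : nat) (LL UU : nat -> nat -> nat -> nat -> F).
Variables (s0 : (nat -> nat -> F) * (nat -> nat -> F)).

(** The factors at a vertex, along the path that goes right first.  These are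
    total functions, and only on the rectangle are they related by edges. *)
Fixpoint bottom_vertex a :=
  if a is a'.+1 then edge_target (LL 0 a') (bottom_vertex a') else s0.

Fixpoint vertex b a :=
  if b is b'.+1 then
    swap_sides (edge_target (trm (UU b a)) (swap_sides (vertex b' a)))
  else bottom_vertex a.

Hypothesis bLL : forall b a, (b <= q)%N -> (a < p)%N -> lower_bidiagonal (LL b a).
Hypothesis bUU : forall b a, (b < q)%N -> (a <= p)%N ->
  lower_bidiagonal (trm (UU b.+1 a)).
Hypothesis UUL : forall b a, (b < q)%N -> (a < p)%N ->
  UU b.+1 a ** LL b a = LL b.+1 a ** UU b.+1 a.+1.
Hypothesis bottom_edge : forall a, (a < p)%N ->
  edge (LL 0 a) (vertex 0 a) (vertex 0 a.+1).
Hypothesis left_edge : forall b, (b < q)%N ->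
  edge (trm (UU b.+1 0)) (swap_sides (vertex b 0)) (swap_sides (vertex b.+1 0)).

(** Induction on rows: the column edges of row b and one row edge on the left
    give, square by square, all row edges out of row b and the column edges of
    row b + 1. *)
Lemma rectangle_edges b : (b <= q)%N ->
  (forall a, (a < p)%N -> edge (LL b a) (vertex b a) (vertex b a.+1)) /\
  ((b < q)%N -> forall a, (a <= p)%N ->
     edge (trm (UU b.+1 a)) (swap_sides (vertex b a)) (swap_sides (vertex b.+1 a))).
Proof.
have row b' : (b' < q)%N ->
    (forall a, (a < p)%N -> edge (LL b' a) (vertex b' a) (vertex b' a.+1)) ->
  forall a, (a <= p)%N ->
    edge (trm (UU b'.+1 a)) (swap_sides (vertex b' a)) (swap_sides (vertex b'.+1 a)) /\
    ((a < p)%N -> edge (LL b'.+1 a) (vertex b'.+1 a) (vertex b'.+1 a.+1)).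
  move=> bq col.
  have edges a : (a <= p)%N ->
      edge (trm (UU b'.+1 a)) (swap_sides (vertex b' a)) (swap_sides (vertex b'.+1 a)).
    elim: a => [|a IH] ap; first exact: left_edge.
    have [_ e] := complete_square (bLL (ltnW bq) ap) (bLL bq ap) (bUU bq (ltnW ap))
      (bUU bq ap) (UUL bq ap) (col _ ap) (IH (ltnW ap)).
    by rewrite /= -(edge_step (bUU bq ap) e) swap_sidesK.
  move=> a ap; split=> [|{}ap]; first exact: edges.
  have [e1 e2] := complete_square (bLL (ltnW bq) ap) (bLL bq ap) (bUU bq (ltnW ap))
    (bUU bq ap) (UUL bq ap) (col _ ap) (edges _ (ltnW ap)).
  rewrite [vertex _ a.+1](_ : _ = edge_target (LL b'.+1 a) (vertex b'.+1 a))//.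
  by rewrite [LHS]/= -(edge_step (bUU bq ap) e2) swap_sidesK.
have cols : (b <= q)%N -> forall a, (a < p)%N ->
    edge (LL b a) (vertex b a) (vertex b a.+1).
  elim: b => [|b IH] bq a ap; first exact: bottom_edge.
  by have [_] := row b bq (IH (ltnW bq)) a (ltnW ap); apply.
move=> bq; split=> [|{}bq a ap]; first exact: cols.
by have [] := row b bq (cols (ltnW bq)) a ap.
Qed.

Lemma rectangle_gauss_borel M : gauss_borel M s0.1 s0.2 ->
  forall b a, (b <= q)%N -> (a <= p)%N ->
  gauss_borel (fun r s => M (r + b)%N (s + a)%N) (vertex b a).1 (vertex b a).2.
Proof.
move=> gb0 b a bq ap; elim: b bq => [_|b IH bq].
  elim: a ap => [_|a IH ap].
    rewrite [X in gauss_borel X](_ : _ = M)//.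
    by apply/funext => r; apply/funext => s; rewrite !addn0.
  have := edge_gauss_borel (bLL (leq0n q) ap) (bottom_edge ap) (IH (ltnW ap)).
  rewrite [X in gauss_borel X](_ : _ = fun r s => M (r + 0)%N (s + a.+1)%N)//.
  by apply/funext => r; apply/funext => s; rewrite /dropcols -addnA add1n.
have [_ /(_ bq a ap) e] := rectangle_edges (ltnW bq).
have := gauss_borel_trm (edge_gauss_borel (bUU bq ap) e
  (gauss_borel_trm (IH (ltnW bq)))).
rewrite [X in gauss_borel X](_ : _ = fun r s => M (r + b.+1)%N (s + a)%N)//.
by apply/funext => r; apply/funext => s; rewrite /trm /dropcols -addnA add1n.
Qed.

End rectangle.

(** * Integration of polynomials against signed measures *)

Section density.
Context d (T : measurableType d) (R : realType).
Variables (mu : {finite_measure set T -> \bar R}) (h : T -> \bar R).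
Hypothesis inth : mu.-integrable [set: T] h.
Hypothesis h_ge0 : forall x, (0 <= h x)%E.
Local Open Scope ereal_scope.

Lemma induced_charge_ge0 A : 0 <= induced_charge inth A.
Proof. exact: integral_ge0. Qed.

(** The measure h mu; the charge that it comes from is nonnegative on all sets,
    measurable or not. *)
Definition density := measure_of_charge (induced_charge inth) induced_charge_ge0.

HB.instance Definition _ := Measure.on density.

Let density_finite : fin_num_fun density.
Proof. by move=> A mA; exact: (fin_num_measure (induced_charge inth)). Qed.

HB.instance Definition _ :=
  @Measure_isFinite.Build _ _ _ density density_finite.

(** h is almost everywhere the Radon-Nikodym derivative of h mu. *)
Lemma ge0_integral_density (f : T -> \bar R) : (forall x, 0 <= f x) ->
    measurable_fun [set: T] f ->
  \int[density]_x f x = \int[mu]_x (f x * h x).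
Proof.
move=> f0 mf; have mh := measurable_int _ inth.
have dmu : density `<< mu.
  apply/null_content_dominatesP => A mA muA; apply: null_set_integral => //.
  exact: measurable_funTS.
rewrite -(Radon_Nikodym_SigmaFinite.change_of_variables dmu)//.
have intRN := Radon_Nikodym_SigmaFinite.f_integrable dmu.
apply: ae_eq_integral => //.
- exact: emeasurable_funM (measurable_int _ intRN).
- exact: emeasurable_funM.
apply: ae_eqe_mul2l; apply: integral_ae_eq => // A _ mA.
by rewrite -Radon_Nikodym_SigmaFinite.f_integral.
Qed.

Lemma integral_density (f : T -> \bar R) : measurable_fun [set: T] f ->
    mu.-integrable [set: T] (fun x => f x * h x) ->
  density.-integrable [set: T] f /\
  \int[density]_x f x = \int[mu]_x (f x * h x).
Proof.
move=> mf intfh; split.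
  apply/integrableP; split=> //.
  rewrite ge0_integral_density //; last exact: measurableT_comp.
  move/integrableP : intfh => [_].
  by under eq_integral do rewrite abseM (gee0_abs (h_ge0 _)).
rewrite [LHS]integralE [RHS]integralE.
have max_mul (a b : \bar R) : 0 <= b -> maxe (a * b) 0 = maxe a 0 * b.
  move=> b0; have [a0|/ltW a0] := leP 0 a.
    by rewrite !max_l// mule_ge0.
  by rewrite !max_r ?mul0e// mule_le0_ge0.
have fhpos x : (fun x => f x * h x)^\+ x = f^\+ x * h x.
  by rewrite !funeposE max_mul.
have fhneg x : (fun x => f x * h x)^\- x = f^\- x * h x.
  by rewrite !funenegE -mulNe max_mul.
congr (_ - _).
  rewrite ge0_integral_density //; last exact: measurable_funepos.
  exact: eq_integral.
rewrite ge0_integral_density //; last exact: measurable_funeneg.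
exact: eq_integral.
Qed.

End density.

Section signed_integration.
Variable R : realType.
Implicit Types (nu : {charge set R -> \bar R}) (f g : {poly R}).

Lemma measurable_EFin_horner f : measurable_fun [set: R] (EFin \o horner f).
Proof. by apply/measurable_EFinP; exact: measurable_poly. Qed.

Lemma integrable_le (m1 m2 : {measure set R -> \bar R}) f :
    (forall A, measurable A -> (m1 A <= m2 A)%E) ->
    m2.-integrable [set: R] (EFin \o horner f) ->
  m1.-integrable [set: R] (EFin \o horner f).
Proof.
move=> m12 /integrableP[mf fin]; apply/integrableP; split=> //.
apply: le_lt_trans fin; apply: ge0_le_measure_integral => //.
exact: measurableT_comp.
Qed.

Section difference.
Variables (nu : {charge set R -> \bar R}) (m1 m2 : {measure set R -> \bar R}).
Hypothesis fin_m2 : forall A, measurable A -> m2 A \is a fin_num.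
Hypothesis nuE : forall A, measurable A -> (nu A = m1 A - m2 A)%E.

Let mp := jordan_pos (hahn nu).
Let mn := jordan_neg (hahn nu).

Let le_pos A : measurable A -> (mp A <= m1 A)%E.
Proof.
move=> mA; have [[mP _] _ _ _] := hahn nu.
rewrite /mp jordan_posE cjordan_posE /crestr0 mem_set// /crestr nuE.
  apply: (@le_trans _ _ (m1 (A `&` (projT1 (cid (hahn_exists nu))).1))).
    by rewrite leeBlDr ?fin_m2 ?leeDl//; exact: measurableI.
  by apply: le_measure; rewrite ?inE//; exact: measurableI.
exact: measurableI.
Qed.

Let le_neg A : measurable A -> (mn A <= m2 A)%E.
Proof.
move=> mA; have [_ [mN _] _ _] := hahn nu.
have mAN := measurableI _ _ mA mN.
rewrite /mn jordan_negE cjordan_negE /crestr0 mem_set// /crestr nuE//.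
rewrite fin_num_oppeB ?fin_m2//.
apply: (@le_trans _ _ (m2 (A `&` (projT1 (cid (hahn_exists nu))).2))).
  by rewrite -[leRHS]add0e leeD2r// leeNl oppe0 measure_ge0.
by apply: le_measure; rewrite ?inE.
Qed.

Let addE A : measurable A -> measure_add mp m2 A = measure_add m1 mn A.
Proof.
move=> mA; rewrite !measure_addE.
have := nuE mA; rewrite (jordan_decomp (hahn nu) mA) /cadd/= cscaleN1 /=.
have : mp A \is a fin_num by exact: fin_num_measure.
have : mn A \is a fin_num by exact: fin_num_measure.
have := fin_m2 mA.
rewrite -/mp -/mn.
move: (mp A) (mn A) (m2 A) (m1 A) => [a| |] [b| |] [c| |] [e| |] //= _ _ _.
by rewrite -!EFinD => -[/eqP]; rewrite subr_eq addrAC eq_sym subr_eq => /eqP <-.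
Qed.

(** Any representation of a charge as a difference of finite measures computes
    its integrals: the Jordan parts are dominated by m1 and m2, and
    pos + m2 = m1 + neg as measures. *)
Lemma signed_integral_difference f :
    m1.-integrable [set: R] (EFin \o horner f) ->
    m2.-integrable [set: R] (EFin \o horner f) ->
  integrable_poly nu f /\ cint nu f = \int[m1]_x f.[x] - \int[m2]_x f.[x].
Proof.
move=> i1 i2.
have ip : mp.-integrable [set: R] (EFin \o horner f) := integrable_le le_pos i1.
have iN : mn.-integrable [set: R] (EFin \o horner f) := integrable_le le_neg i2.
split; first by [].
have : (\int[mp]_x (f.[x])%:E + \int[m2]_x (f.[x])%:E =
        \int[m1]_x (f.[x])%:E + \int[mn]_x (f.[x])%:E)%E.
  rewrite -!integral_measure_add//; try exact: measurable_EFin_horner.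
  by apply: eq_measure_integral => A mA _; exact: addE.
rewrite /cint /Rintegral -/mp -/mn.
have := integrable_fin_num measurableT ip.
have := integrable_fin_num measurableT iN.
have := integrable_fin_num measurableT i1.
have := integrable_fin_num measurableT i2.
rewrite /comp.
move: (\int[mp]_x _)%E (\int[mn]_x _)%E (\int[m1]_x _)%E (\int[m2]_x _)%E.
move=> [a| |] [b| |] [c| |] [e| |] //= _ _ _ _.
rewrite -!EFinD => -[] /eqP; rewrite -subr_eq => /eqP <-.
by rewrite addrAC addrK.
Qed.

End difference.

(** Integrability and value together, so that both go through one induction over
    a sum of charges or of polynomials. *)
Definition has_cint nu f (c : R) := integrable_poly nu f /\ cint nu f = c.

(** Representing the charge as f^+ mu - f^- mu. *)
Lemma has_cint_induced (mu : {finite_measure set R -> \bar R}) f g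
    (intf : mu.-integrable [set: R] (fun x => (f.[x])%:E)) :
    mu.-integrable [set: R] (fun x => ((f * g).[x])%:E) ->
  has_cint (induced_charge intf) g (\int[mu]_x (f * g).[x]).
Proof.
move=> intfg.
have mf := measurable_EFin_horner f; have mg := measurable_EFin_horner g.
have ip : mu.-integrable [set: R] (EFin \o horner f)^\+%E.
  exact: integrable_funepos.
have iN : mu.-integrable [set: R] (EFin \o horner f)^\-%E.
  exact: integrable_funeneg.
have ip0 x : (0 <= (EFin \o horner f)^\+ x)%E by exact: funepos_ge0.
have iN0 x : (0 <= (EFin \o horner f)^\- x)%E by exact: funeneg_ge0.
have igp : mu.-integrable [set: R] (fun x => (g.[x])%:E * (EFin \o horner f)^\+ x)%E.
  apply: le_integrable intfg => //.
    by apply: emeasurable_funM => //; exact: measurable_funepos.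
  move=> x _; rewrite hornerM mulrC EFinM !abseM lee_wpmul2l// gee0_abs//.
  by rewrite -[leRHS]/((abse \o (EFin \o horner f)) x) fune_abse leeDl.
have ign : mu.-integrable [set: R] (fun x => (g.[x])%:E * (EFin \o horner f)^\- x)%E.
  apply: le_integrable intfg => //.
    by apply: emeasurable_funM => //; exact: measurable_funeneg.
  move=> x _; rewrite hornerM mulrC EFinM !abseM lee_wpmul2l// gee0_abs//.
  by rewrite -[leRHS]/((abse \o (EFin \o horner f)) x) fune_abse leeDr.
have [gp gpE] := integral_density ip ip0 mg igp.
have [gn gnE] := integral_density iN iN0 mg ign.
have [||gi giE] := signed_integral_difference (nu := induced_charge intf) _ _ gp gn.
- by move=> A mA; exact: fin_num_measure.
- by move=> A mA; exact: integralE.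
split=> //; rewrite giE.
rewrite /Rintegral gpE gnE -fineB; first last.
- exact: integrable_fin_num.
- exact: integrable_fin_num.
rewrite -integralB//; congr fine; apply: eq_integral => x _.
rewrite -muleBr ?add_def_funeposneg//.
have /(congr1 (fun h => h x)) /= <- := funeposneg (EFin \o horner f).
by rewrite hornerM mulrC.
Qed.

Lemma integrable_measure_add (m1 m2 : {measure set R -> \bar R}) f :
    m1.-integrable [set: R] (EFin \o horner f) ->
    m2.-integrable [set: R] (EFin \o horner f) ->
  (measure_add m1 m2).-integrable [set: R] (EFin \o horner f).
Proof.
move=> /integrableP[mf i1] /integrableP[_ i2]; apply/integrableP; split=> //.
rewrite ge0_integral_measure_add//; last exact: measurableT_comp.
exact: lte_add_pinfty.
Qed.

Lemma Rintegral_measure_add (m1 m2 : {measure set R -> \bar R}) f :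
    m1.-integrable [set: R] (EFin \o horner f) ->
    m2.-integrable [set: R] (EFin \o horner f) ->
  \int[measure_add m1 m2]_x f.[x] = \int[m1]_x f.[x] + \int[m2]_x f.[x].
Proof.
move=> i1 i2; rewrite /Rintegral integral_measure_add//.
by rewrite fineD//; exact: integrable_fin_num.
Qed.

Lemma has_cint_addc nu1 nu2 f c1 c2 :
  has_cint nu1 f c1 -> has_cint nu2 f c2 ->
  has_cint (addc nu1 nu2) f (c1 + c2).
Proof.
move=> [[p1 n1] <-] [[p2 n2] <-].
have [||i iE] := signed_integral_difference (nu := addc nu1 nu2) _ _
  (integrable_measure_add p1 p2) (integrable_measure_add n1 n2).
- move=> A mA; rewrite -[X in X \is a _]/(measure_add _ _ A) measure_addE.
  by rewrite fin_numD; apply/andP; split; exact: fin_num_measure.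
- move=> A mA; rewrite -[X in (_ = X - _)%E]/(measure_add _ _ A).
  rewrite -[X in (_ = _ - X)%E]/(measure_add _ _ A) !measure_addE.
  rewrite -[LHS]/(nu1 A + nu2 A)%E.
  rewrite (jordan_decomp (hahn nu1) mA) (jordan_decomp (hahn nu2) mA).
  rewrite /cadd/= !cscaleN1 fin_num_oppeD; last exact: fin_num_measure.
  by rewrite addeACA.
split=> //; rewrite iE (Rintegral_measure_add p1 p2) (Rintegral_measure_add n1 n2).
by rewrite opprD addrACA.
Qed.

Lemma has_cint_oppc nu f c : has_cint nu f c -> has_cint (oppc nu) f (- c).
Proof.
move=> [[p n] <-].
have [||i iE] := signed_integral_difference (nu := oppc nu) _ _ n p.
- by move=> A mA; exact: fin_num_measure.
- move=> A mA; rewrite /oppc/= /copp/= (jordan_decomp (hahn nu) mA).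
  rewrite /cadd/= !cscaleN1 fin_num_oppeB 1?addeC//; exact: fin_num_measure.
by split=> //; rewrite iE opprB.
Qed.

Lemma has_cint_zeroc f : has_cint (zeroc R) f 0.
Proof.
have i0 : mzero.-integrable [set: R] (EFin \o horner f).
  apply/integrableP; split; first exact: measurable_EFin_horner.
  by rewrite integral_measure_zero.
have [||i iE] := signed_integral_difference (nu := zeroc R) _ _ i0 i0.
- by [].
- by move=> A mA; rewrite /zeroc/= /czero/= /mzero subee.
by split=> //; rewrite iE subrr.
Qed.

Lemma has_cint_densc f g nu : integrable_poly nu f -> integrable_poly nu (f * g) ->
  has_cint (densc f nu) g (cint nu (f * g)).
Proof.
move=> intf [ip iN]; rewrite /densc; case: pselect => // h.
by apply: has_cint_addc; [|apply: has_cint_oppc]; exact: has_cint_induced.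
Qed.

Lemma has_cintD nu f g c1 c2 :
  has_cint nu f c1 -> has_cint nu g c2 -> has_cint nu (f + g) (c1 + c2).
Proof.
move=> [[p1 n1] <-] [[p2 n2] <-].
have fgE : (fun x => ((f + g).[x])%:E) =
    ((fun x => (f.[x])%:E) \+ (fun x => (g.[x])%:E))%E.
  by apply/funext => x /=; rewrite hornerD EFinD.
split; first by split; rewrite fgE; exact: integrableD.
rewrite /cint addrACA -opprD -!RintegralD//.
by congr (_ - _); apply: eq_Rintegral => x _; rewrite hornerD.
Qed.

Lemma has_cintZ nu f a c : has_cint nu f c -> has_cint nu (a *: f) (a * c).
Proof.
move=> [[p n] <-].
have fE : (fun x => ((a *: f).[x])%:E) = (fun x => a%:E * (f.[x])%:E)%E.
  by apply/funext => x /=; rewrite hornerZ EFinM.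
split; first by split; rewrite fE; exact: integrableZl.
rewrite /cint mulrBr; congr (_ - _); rewrite -RintegralZl//;
  by apply: eq_Rintegral => x _; rewrite hornerZ.
Qed.

Lemma has_cint0 nu : has_cint nu 0 0.
Proof.
have h0 : (fun x => ((0 : {poly R}).[x])%:E) = cst 0%E.
  by apply/funext => x; rewrite horner0.
split; first by split; rewrite h0; exact: integrable0.
by rewrite /cint /Rintegral h0 !integral0 subrr.
Qed.

End signed_integration.

(** * Arrays of polynomials along the step-line *)

Section stepline_coefficients.
Variables (R : realType) (r : nat) (hr : (0 < r)%N).
Implicit Types B : nat -> 'I_r -> {poly R}.

Definition residue n : 'I_r := Ordinal (ltn_pmod n hr).

Lemma residue_ord (s : 'I_r) : residue s = s.
Proof. by apply: val_inj; rewrite /= modn_small. Qed.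

Lemma residueMD u (s : 'I_r) : residue (u * r + s) = s.
Proof. by apply: val_inj; rewrite /= modnMDl modn_small. Qed.

Lemma quotientMD u (s : 'I_r) : ((u * r + s) %/ r)%N = u.
Proof. by rewrite divnMDl// divn_small// addn0. Qed.

Lemma residueS n : residue (residue n).+1 = residue n.+1.
Proof. by apply: val_inj; rewrite /= -[in LHS]addn1 modnDml addn1. Qed.

Lemma dvdnS_residue n : (r %| n.+1)%N = ((residue n).+1 == r).
Proof.
rewrite /dvdn -[(n.+1 %% r)%N]/(val (residue n.+1)) -residueS /=.
have [->|nr] := eqVneq (n %% r).+1 r; first by rewrite modnn.
by rewrite modn_small// ltn_neqAle nr ltn_mod.
Qed.

Lemma sum_divmod (V : nmodType) (f : nat -> 'I_r -> V) N :
  \sum_(n < N * r) f (n %/ r)%N (residue n) = \sum_(u < N) \sum_(s < r) f u s.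
Proof.
elim: N => [|N IH]; first by rewrite mul0n !big_ord0.
rewrite big_ord_recr/= -IH mulSnr big_split_ord/=; congr (_ + _).
by apply: eq_bigr => s _; rewrite quotientMD residueMD.
Qed.

Definition coefs B : nat -> nat -> R := fun n s => (B n (residue s))`_(s %/ r).

Lemma coefs_inj B B' : coefs B = coefs B' -> B = B'.
Proof.
move=> e; apply/funext => n; apply/funext => s; apply/polyP => u.
have := congr1 (fun Z => Z n (u * r + s)%N) e.
by rewrite /coefs quotientMD residueMD.
Qed.

Lemma coefs_mulm (X : nat -> nat -> R) B : row_finite X ->
  coefs (mapm polyC X ** B) = X ** coefs B.
Proof.
move=> fX; apply/funext => n; apply/funext => s; have [N hN] := fX n.
rewrite /coefs !(mulm_bound (N := N)).
- by rewrite coef_sum; apply: eq_bigr => k _; rewrite coefCM.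
- by move=> k /hN ->; rewrite mul0r.
- by move=> k /hN XE; rewrite /mapm XE polyC0 mul0r.
Qed.

Lemma coefs_scaleX B : coefs (scalem 'X B) = padcols r (coefs B).
Proof.
apply/funext => n; apply/funext => s; rewrite /coefs /scalem /padcols mulrC coefMX.
case: (ltnP s r) => [sr|rs]; first by rewrite divn_small.
have {s rs} [t ->] : exists t, s = (t + r)%N by exists (s - r)%N; rewrite subnK.
rewrite addnK divnDr// divnn hr addn1 /=; congr ((B n _)`_ _).
by apply: val_inj; rewrite /= modnDr.
Qed.

(** K_r is a diagonal matrix times a cyclic permutation matrix. *)
Lemma KmxE (i j : 'I_r) :
  Kmx R r i j = (if i.+1 == r then 'X else 1) * (residue i.+1 == j)%:R.
Proof.
rewrite mxE -[residue _ == j]val_eqE /=; have [ir|ir] := eqVneq i.+1 r.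
  rewrite ir modnn (ltn_eqF (ltn_ord j)) andbT eq_sym.
  by case: eqP; rewrite (mulr1, mulr0).
rewrite modn_small; last by rewrite ltn_neqAle ir ltn_ord.
by rewrite andbF eq_sym mul1r; case: eqP.
Qed.

(** In terms of coefficients K_r is the shift: it moves component j to j + 1,
    and the last component to the first one with one more power of x. *)
Lemma coefs_mulK B : coefs (B ** Kmx R r) = padcols 1 (coefs B).
Proof.
apply/funext => n; apply/funext => s; rewrite /coefs /padcols mulm_fin.
under eq_bigr do rewrite KmxE.
case: s => [|s] /=.
  rewrite div0n coef_sum big1// => k _; case: ifP => [|kr].
    by rewrite mulrA -mulrA mulr_natr mulrnAr coefMn coefMX mul0rn.
  rewrite -val_eqE /= mod0n modn_small ?mulr0 ?coef0//.
  by rewrite ltn_neqAle kr ltn_ord.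
rewrite subn1 /= (bigD1 (residue s))//= big1 ?addr0 => [|k ks].
  rewrite residueS eqxx mulr1 divnS// dvdnS_residue.
  case: eqP => _; first by rewrite coefMX add1n.
  by rewrite mulr1.
rewrite (_ : residue _ == _ = false) ?mulr0 ?coef0//; apply: contraNF ks.
rewrite -val_eqE /= -addn1 -[s.+1]addn1 eqn_modDr (modn_small (ltn_ord k)).
by rewrite -val_eqE.
Qed.

(** The vector x^u e_j with n = r u + j is sent by K_r^b to the vector with
    number n + b. *)
Lemma Kmx_powE b n (k : 'I_r) :
  'X^(n %/ r) * (Kmx R r ^+ b) (residue n) k =
  (if k == residue (n + b) then 'X^((n + b) %/ r) else 0) :> {poly R}.
Proof.
elim: b k => [|b IH] k.
  by rewrite expr0 addn0 !mxE eq_sym; case: eqP; rewrite (mulr1, mulr0).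
rewrite exprSr -mulmxE mxE mulr_sumr.
under eq_bigr do rewrite mulrA IH KmxE.
rewrite (bigD1 (residue (n + b)))//= eqxx big1 ?addr0 => [|l /negPf ->]; last first.
  by rewrite mul0r.
rewrite addnS residueS divnS// dvdnS_residue [k == _]eq_sym mulrA.
by case: eqP => _; case: eqP => _; rewrite !(mulr1, mulr0) ?exprS 1?mulrC.
Qed.

Lemma lower_coefs B : (forall n, stepline_space n (B n)) <-> lower (coefs B).
Proof.
split=> [spB n s ns|lB n s].
  rewrite /coefs nth_default// (leq_trans (spB n (residue s)))//=.
  case: (leqP (s %% r) (n %% r)) => [sn|_]; last by rewrite leq_div2r// ltnW.
  rewrite ltnNge; apply: contraTN ns => le_sn; rewrite -leqNgt.
  by rewrite (divn_eq n r) (divn_eq s r) leq_add// leq_mul2r le_sn orbT.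
apply/leq_sizeP => u hu.
have := lB n (u * r + s)%N; rewrite /coefs quotientMD residueMD; apply.
rewrite (divn_eq n r); move: hu; case: (leqP s (n %% r)) => [_|sn] nu.
  apply: (@leq_trans ((n %/ r).+1 * r)%N).
    by rewrite mulSn addnC ltn_add2r ltn_mod.
  by rewrite (leq_trans _ (leq_addr _ _))// leq_mul2r nu orbT.
by rewrite -addnS leq_add// leq_mul2r nu orbT.
Qed.

Definition polys (S : nat -> nat -> R) : nat -> 'I_r -> {poly R} :=
  fun n s => \poly_(u < n.+1) S n (u * r + s)%N.

Lemma polysK S : lower S -> coefs (polys S) = S.
Proof.
move=> lS; apply/funext => n; apply/funext => s; rewrite /coefs /polys coef_poly /=.
rewrite -divn_eq; case: ltnP => // ns; rewrite lS//.
by rewrite (leq_trans ns)// leq_div.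
Qed.

Lemma coefsK B : lower (coefs B) -> polys (coefs B) = B.
Proof. by move=> lB; apply: coefs_inj; rewrite polysK. Qed.

Lemma Erow_mulm (A : pzSemiRingType) (J : Type) (X : nat -> J -> A) :
  Erow A (r := r) ** X = fun i j => X i j.
Proof.
apply/funext => i; apply/funext => j; rewrite /mulm (fsbigE [:: val i])//.
  by rewrite big_mkcond big_seq1 in_setT /Erow eqxx mul1r.
by move=> k _; rewrite inE /Erow eq_sym => /negPf ->; rewrite mul0r.
Qed.

Lemma initial_coefs B : lower (coefs B) ->
  Erow {poly R} (r := r) ** B = mapm polyC (\matrix_(i, j) coefs B i j : 'M[R]_r).
Proof.
move=> lB; rewrite Erow_mulm; apply/funext => i; apply/funext => j.
rewrite /mapm mxE; apply/polyP => u; rewrite coefC.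
have := lB i (u * r + j)%N; rewrite /coefs quotientMD residueMD.
case: u => [|u] /= h; first by rewrite divn_small// residue_ord.
by apply: h; rewrite mulSn -addnA ltn_addr.
Qed.

Lemma Kfrac_unit : Kfrac R r \in unitmx.
Proof.
have f_inj : injective (fun i : 'I_r => residue i.+1).
  move=> i j /(congr1 val) /= /eqP; rewrite -[i.+1]addn1 -[j.+1]addn1 eqn_modDr.
  by rewrite !modn_small// => /eqP/val_inj.
have -> : Kfrac R r =
    diag_mx (\row_i (if i.+1 == r then tofrac 'X else 1)) *m perm_mx (perm f_inj).
  apply/matrixP => i j; rewrite mul_diag_mx [LHS]mxE KmxE !mxE permE.
  by rewrite rmorphM/= rmorph_nat; case: ifP; rewrite ?rmorph1.
rewrite unitmx_mul unitmx_perm andbT unitmxE det_diag unitfE.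
apply/prodf_neq0 => i _; rewrite mxE; case: ifP => _; last exact: oner_neq0.
by rewrite tofrac_eq0 polyX_eq0.
Qed.

End stepline_coefficients.

(** * Moments of the Christoffel transforms *)

Section finite_moments.
Variable R : realType.
Implicit Types (nu : {charge set R -> \bar R}) (f g : {poly R}).

Lemma has_cint_sum nu (I : Type) (s : seq I) (P : pred I) (F : I -> {poly R}) c :
    (forall i, P i -> has_cint nu (F i) (c i)) ->
  has_cint nu (\sum_(i <- s | P i) F i) (\sum_(i <- s | P i) c i).
Proof.
move=> h; apply: (big_ind2 (has_cint nu)) => //; first exact: has_cint0.
by move=> f1 c1 f2 c2; exact: has_cintD.
Qed.

Lemma finite_moments_integrable nu f : finite_moments nu -> integrable_poly nu f.
Proof.
move=> fm; rewrite -[f]coefK poly_def.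
have [] // := has_cint_sum (nu := nu) (index_enum 'I_(size f)) (P := xpredT)
  (F := fun u => f`_u *: 'X^u) (c := fun u => f`_u * cint nu 'X^u) _.
by move=> u _; apply: has_cintZ; split.
Qed.

Lemma cint_sumZ nu (I : finType) (a : I -> R) (F : I -> {poly R}) :
    finite_moments nu ->
  cint nu (\sum_i a i *: F i) = \sum_i a i * cint nu (F i).
Proof.
move=> fm; have [] // := has_cint_sum (nu := nu) (index_enum I)
  (P := xpredT) (F := fun i => a i *: F i) (c := fun i => a i * cint nu (F i)) _.
move=> i _; apply: has_cintZ; split=> //; exact: finite_moments_integrable.
Qed.

Lemma cint_mul_expand nu f g M N : finite_moments nu ->
    (size f <= M)%N -> (size g <= N)%N ->
  cint nu (f * g) =
  \sum_(v < N) \sum_(u < M) f`_u * cint nu 'X^(u + v) * g`_v.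
Proof.
move=> fm fM gN.
have expand (h : {poly R}) K : (size h <= K)%N -> h = \sum_(u < K) h`_u *: 'X^u.
  move=> hK; rewrite -poly_def; apply/polyP => i; rewrite coef_poly.
  by case: ltnP => // Ki; rewrite nth_default// (leq_trans hK).
rewrite {1}(expand _ _ gN) mulr_sumr.
under eq_bigr do rewrite -scalerAr.
rewrite cint_sumZ//; apply: eq_bigr => v _.
rewrite {1}(expand _ _ fM) mulr_suml.
under eq_bigr do rewrite -scalerAl -exprD.
rewrite cint_sumZ// mulr_sumr; apply: eq_bigr => u _.
by rewrite mulrC.
Qed.

End finite_moments.

Section moment_matrices.
Variables (R : realType) (q p : nat) (hq : (0 < q)%N) (hp : (0 < p)%N).
Variable Psi : mxcharge R q p.
Hypothesis fm : forall j i, finite_moments (Psi j i).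

Lemma moment_matrixE (Phi : mxcharge R q p) r s : moment_matrix hq hp Phi r s =
  cint (Phi (residue hq r) (residue hp s)) 'X^(r %/ q + s %/ p).
Proof. by rewrite /moment_matrix /stepline mxE. Qed.

Lemma moment_matrix_hankel (Phi : mxcharge R q p) r s :
  moment_matrix hq hp Phi (r + q) s = moment_matrix hq hp Phi r (s + p).
Proof.
rewrite !moment_matrixE !divnDr// !divnn hq hp addnAC addnA.
have res t (ht : (0 < t)%N) n : residue ht (n + t) = residue ht n.
  by apply: val_inj; rewrite /= modnDr.
by rewrite !res.
Qed.

(** Bilinear expansion in the monomial vectors, whose pairings are the entries
    of the moment matrix. *)
Lemma biorthogonal_coefs B A m n :
  \sum_(s < q) \sum_(t < p) cint (Psi s t) (B m s * A t n) =
  (coefs hq B ** moment_matrix hq hp Psi ** trm (coefs hp (trm A))) m n.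
Proof.
pose M := \max_(s < q) size (B m s); pose N := \max_(t < p) size (A t n).
have BM s : (size (B m s) <= M)%N by exact: (leq_bigmax s).
have AN t : (size (A t n) <= N)%N by exact: (leq_bigmax t).
rewrite (mulm_bound (N := N * p)%N); last first.
  move=> l hl; rewrite /trm /coefs [(A _ n)`__]nth_default ?mulr0//.
  by rewrite (leq_trans (AN _))// leq_divRL.
pose f v (t : 'I_p) :=
  \sum_(u < M) \sum_(s < q) (B m s)`_u * cint (Psi s t) 'X^(u + v) * (A t n)`_v.
rewrite [RHS](eq_bigr (fun l : 'I_(N * p) => f (l %/ p)%N (residue hp l))); last first.
  move=> l _; rewrite (mulm_bound (N := M * q)%N); last first.
    move=> k hk; rewrite /coefs nth_default ?mul0r//.
    by rewrite (leq_trans (BM _))// leq_divRL.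
  rewrite mulr_suml /f -(sum_divmod hq (fun u s => (B m s)`_u *
    cint (Psi s (residue hp l)) 'X^(u + l %/ p) * (A (residue hp l) n)`_(l %/ p))).
  by apply: eq_bigr => k _; rewrite moment_matrixE.
rewrite sum_divmod exchange_big /= [RHS]exchange_big /=; apply: eq_bigr => t _.
under eq_bigr do rewrite (cint_mul_expand (fm _ _) (BM _) (AN _)).
by rewrite exchange_big; apply: eq_bigr => v _; rewrite exchange_big.
Qed.

Lemma has_cint_mulmxc P Q j i g :
  has_cint (mulmxc P Psi Q j i) g
    (\sum_(k < q) \sum_(l < p) cint (Psi k l) (P j k * Q l i * g)).
Proof.
rewrite /mulmxc; apply: (big_ind2 (fun nu c => has_cint nu g c)).
- exact: has_cint_zeroc.
- by move=> nu1 c1 nu2 c2; exact: has_cint_addc.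
move=> k _; apply: (big_ind2 (fun nu c => has_cint nu g c)).
- exact: has_cint_zeroc.
- by move=> nu1 c1 nu2 c2; exact: has_cint_addc.
by move=> l _; apply: has_cint_densc; exact: finite_moments_integrable.
Qed.

Lemma finite_moments_christoffel b a j i :
  finite_moments (christoffel Psi b a j i).
Proof.
move=> n.
by have [] := has_cint_mulmxc (Kmx R q ^+ b) (Kmx R p ^+ a)^T j i 'X^n.
Qed.

(** Powers of K permute the monomial vectors along the step-line, so that one
    term of the double sum survives, with shifted indices. *)
Lemma moment_matrix_christoffel b a r s :
  moment_matrix hq hp (christoffel Psi b a) r s =
  moment_matrix hq hp Psi (r + b) (s + a).
Proof.
rewrite !moment_matrixE (has_cint_mulmxc _ _ _ _ _).2.
have KE k l :
    (Kmx R q ^+ b) (residue hq r) k * (Kmx R p ^+ a)^T l (residue hp s) *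
      'X^(r %/ q + s %/ p) =
    (if k == residue hq (r + b) then 'X^((r + b) %/ q) else 0) *
    (if l == residue hp (s + a) then 'X^((s + a) %/ p) else 0).
  rewrite -!Kmx_powE mxE exprD mulrACA.
  by rewrite [X in _ * X]mulrC [X in X * _]mulrC.
under eq_bigr do under eq_bigr do rewrite KE.
have cint0 nu : cint nu 0 = 0 by case: (has_cint0 nu).
rewrite (bigD1 (residue hq (r + b)))//= [X in _ + X]big1 ?addr0 => [|k /negPf kr].
  rewrite (bigD1 (residue hp (s + a)))//= big1 ?addr0 => [|l /negPf ls].
    by rewrite !eqxx exprD.
  by rewrite ls mulr0 cint0.
by apply: big1 => l _; rewrite kr mul0r cint0.
Qed.

End moment_matrices.

(** * Connections and transport as edges *)

Section connections.
Variable R : realType.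

Lemma normalized_lower_bidiagonal (L : nat -> nat -> R) :
  normalized_lower L -> lower_bidiagonal L.
Proof. by move=> [L1 L0]; split=> // k; rewrite L1 oner_neq0. Qed.

Lemma positive_upper_bidiagonal (U : nat -> nat -> R) :
  positive_upper U -> lower_bidiagonal (trm U).
Proof.
move=> [[_ U0] U1]; split=> [k|m n mn mn1]; first by rewrite /trm gt_eqF.
by rewrite /trm U0.
Qed.

(** The single form of both kinds of connection: V acts on the array C without
    shift and its transpose acts on D up to K. *)
Lemma edge_coefs (c d : nat) (hc : (0 < c)%N) (hd : (0 < d)%N) V
    (C C' : nat -> 'I_c -> {poly R}) (D D' : nat -> 'I_d -> {poly R}) :
    lower_bidiagonal V ->
  edge V (coefs hc C, coefs hd D) (coefs hc C', coefs hd D') <->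
  mapm polyC V ** C' = C /\ mapm polyC (trm V) ** D = D' ** Kmx R d.
Proof.
move=> bV; have rV := lower_row_finite (lower_bidiagonal_lower bV).
have cV := lower_bidiagonal_col bV.
rewrite /edge /= -coefs_mulK -!coefs_mulm//.
by split=> [[/coefs_inj e1 /coefs_inj e2]|[-> ->]].
Qed.

Lemma left_array_mulm (d : nat) (V : nat -> nat -> R) (A A' : 'I_d -> nat -> {poly R}) :
  A ** mapm polyC V = A' <-> mapm polyC (trm V) ** trm A = trm A'.
Proof.
rewrite -[mapm polyC (trm V)]/(trm (mapm polyC V)) -(trm_mulm A).
by split=> [->//|/(congr1 (@trm _ _ _))].
Qed.

Lemma trm_Kmx_mulm (d : nat) (A : 'I_d -> nat -> {poly R}) :
  trm ((Kmx R d)^T ** A) = trm A ** Kmx R d.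
Proof.
rewrite trm_mulm; congr (_ ** _).
by apply/funext => i; apply/funext => j; rewrite /trm mxE.
Qed.

Variables (q p : nat) (hq : (0 < q)%N) (hp : (0 < p)%N).
Implicit Types (B : nat -> 'I_q -> {poly R}) (A : 'I_p -> nat -> {poly R}).

Lemma column_edge L B A B' A' : lower_bidiagonal L ->
  edge L (coefs hq B, coefs hp (trm A)) (coefs hq B', coefs hp (trm A')) <->
  A ** mapm polyC L = (Kmx R p)^T ** A' /\ mapm polyC L ** B' = B.
Proof.
move=> bL; rewrite edge_coefs// left_array_mulm trm_Kmx_mulm.
by split=> -[].
Qed.

Lemma row_edge U B A B' A' : lower_bidiagonal (trm U) ->
  edge (trm U) (coefs hp (trm A), coefs hq B) (coefs hp (trm A'), coefs hq B') <->
  mapm polyC U ** B = B' ** Kmx R q /\ A' ** mapm polyC U = A.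
Proof.
move=> bU; rewrite edge_coefs// left_array_mulm.
by split=> -[].
Qed.

End connections.

Section change_of_scalars.
Variables (S S' : comNzRingType) (f : {rmorphism S -> S'}).

Lemma mapm_mulm (I J : Type) (X : I -> nat -> S) (Y : nat -> J -> S) :
  row_finite X -> mapm f (X ** Y) = mapm f X ** mapm f Y.
Proof.
move=> fX; apply/funext => i; apply/funext => j; have [N hN] := fX i.
rewrite /mapm !(mulm_bound (N := N)).
- by rewrite rmorph_sum; apply: eq_bigr => k _; rewrite rmorphM.
- by move=> k /hN ->; rewrite rmorph0 mul0r.
- by move=> k /hN ->; rewrite mul0r.
Qed.

Lemma mapm_mulm_trm (I J : Type) (X : I -> nat -> S) (Y : nat -> J -> S) :
  row_finite (trm Y) -> mapm f (X ** Y) = mapm f X ** mapm f Y.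
Proof.
move=> fY; rewrite -[LHS]/(trm (mapm f (trm (X ** Y)))) trm_mulm.
by rewrite mapm_mulm// trm_mulm.
Qed.

Lemma mapm_mulm_fin (I J : Type) (K : finType) (X : I -> K -> S) (Y : K -> J -> S) :
  mapm f (X ** Y) = mapm f X ** mapm f Y.
Proof.
apply/funext => i; apply/funext => j.
rewrite /mapm !mulm_fin rmorph_sum; apply: eq_bigr => k _; exact: rmorphM.
Qed.

Lemma mulmxK_arrays r (I : Type) (X : I -> 'I_r -> S) (K K' : 'M[S]_r) :
  K *m K' = 1%:M -> X ** K ** K' = X.
Proof.
move=> KK'; apply/funext => i; apply/funext => j.
rewrite mulm_fin; under eq_bigr do rewrite mulm_fin mulr_suml.
rewrite exchange_big /=.
have e l : \sum_k X i l * K l k * K' k j = X i l * (l == j)%:R.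
  under eq_bigr do rewrite -mulrA.
  rewrite -mulr_sumr; congr (_ * _).
  by have := congr1 (fun Z : 'M[S]_r => Z l j) KK'; rewrite !mxE.
under eq_bigr do rewrite e.
by rewrite (bigD1 j)//= eqxx mulr1 big1 ?addr0// => l /negPf ->; rewrite mulr0.
Qed.

Lemma mulKmx_arrays r (J : Type) (X : 'I_r -> J -> S) (K K' : 'M[S]_r) :
  K' *m K = 1%:M -> K' ** (K ** X) = X.
Proof.
move=> K'K; have e (L : 'M[S]_r) : trm (L^T : 'I_r -> 'I_r -> S) = L.
  by apply/funext => i; apply/funext => j; rewrite /trm mxE.
have : trm X ** K^T ** K'^T = trm X.
  by apply: mulmxK_arrays; rewrite -trmx_mul K'K trmx1.
by move=> /(congr1 (@trm _ _ _)); rewrite !trm_mulm !e.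
Qed.

End change_of_scalars.

Section transport_steps.
Variables (R : realType) (q p : nat) (hq : (0 < q)%N) (hp : (0 < p)%N).
Implicit Types (B : nat -> 'I_q -> {poly R}) (A : 'I_p -> nat -> {poly R}).
Let frac := @tofrac {poly R}.

Lemma lower_inverse_array (c : nat) (hc : (0 < c)%N) V (C C' : nat -> 'I_c -> {poly R}) :
    lower_bidiagonal V -> mapm polyC V ** C' = C ->
  mapm polyC (trig_inv V) ** C = C'.
Proof.
move=> bV VC; have lV := lower_bidiagonal_lower bV.
have lVi := lower_trig_inv lV (lb_diag bV).
apply: (@coefs_inj _ _ hc); rewrite -VC !coefs_mulm; try exact: lower_row_finite.
rewrite mulmA_rr; [|exact: lower_row_finite..].
by rewrite (trig_inv_mulm lV (lb_diag bV)) mul1m.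
Qed.

(** Dividing by K is exact along an edge, so the transported rational functions
    are the polynomials of the target. *)
Lemma column_step_edge L B A B' A' : lower_bidiagonal L ->
    edge L (coefs hq B, coefs hp (trm A)) (coefs hq B', coefs hp (trm A')) ->
  column_step L (to_arrays B A) = to_arrays B' A'.
Proof.
move=> bL /column_edge -/(_ bL)[AL LB]; rewrite /column_step /to_arrays /=.
have ratcE X : mapm (@ratc R) X = mapm frac (mapm polyC X) by [].
have lL := lower_bidiagonal_lower bL; have lLi := lower_trig_inv lL (lb_diag bL).
congr (_, _).
  rewrite ratcE -mapm_mulm; last first.
    by apply: lower_row_finite => m n mn; rewrite /mapm lLi.
  by rewrite (lower_inverse_array hq bL LB).
rewrite ratcE -mapm_mulm_trm; last first.
  move=> n; have [N hN] := lower_bidiagonal_col bL n; exists N => k /hN.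
  by rewrite /trm /mapm => ->.
rewrite AL mapm_mulm_fin.
rewrite (_ : mapm frac _ = (Kfrac R p)^T :> ('I_p -> 'I_p -> _)); last first.
  by apply/funext => i; apply/funext => j; rewrite /mapm !mxE.
by apply: mulKmx_arrays; rewrite mulVmx// unitmx_tr Kfrac_unit.
Qed.

Lemma row_step_edge U B A B' A' : lower_bidiagonal (trm U) ->
    edge (trm U) (coefs hp (trm A), coefs hq B) (coefs hp (trm A'), coefs hq B') ->
  row_step U (to_arrays B A) = to_arrays B' A'.
Proof.
move=> bU /row_edge -/(_ bU)[UB AU]; rewrite /row_step /to_arrays /=.
have ratcE X : mapm (@ratc R) X = mapm frac (mapm polyC X) by [].
have lU := lower_bidiagonal_lower bU; have lUi := lower_trig_inv lU (lb_diag bU).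
congr (_, _).
  rewrite ratcE -mapm_mulm; last first.
    move=> n; have [N hN] := lower_bidiagonal_col bU n; exists N => k /hN.
    by rewrite /trm /mapm => ->.
  rewrite UB mapm_mulm_fin.
  rewrite (_ : mapm frac (Kmx R q) = Kfrac R q :> ('I_q -> 'I_q -> _)); last first.
    by apply/funext => i; apply/funext => j; rewrite /mapm !mxE.
  by apply: mulmxK_arrays; rewrite mulmxV// Kfrac_unit.
rewrite ratcE -mapm_mulm_trm; last first.
  rewrite -[trm (mapm _ _)]/(mapm polyC (trm (trig_inv U))) -trig_inv_trm.
  by apply: lower_row_finite => m n mn; rewrite /mapm lUi.
congr mapm; apply/left_array_mulm; rewrite -trig_inv_trm.
by apply: lower_inverse_array => //; apply/left_array_mulm.
Qed.

End transport_steps.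

(** * Recurrence and moments of a single system *)

Section system.
Variables (R : realType) (q p : nat) (hq : (0 < q)%N) (hp : (0 < p)%N).
Variable Phi : mxcharge R q p.
Hypothesis fm : forall j i, finite_moments (Phi j i).
Variables (S G : nat -> nat -> R).
Let M := moment_matrix hq hp Phi.
Hypothesis gb : gauss_borel M S G.

Let lS := gb_lowerl gb.
Let lG := gb_lowerr gb.
Let B := polys (r := q) S.
Let A := trm (polys (r := p) G).
Let T := recmx q M S G 1.
Let xi : 'M[R]_q := \matrix_(i, j) S i j.
Let nu : 'M[R]_p := \matrix_(i, j) G i j.

Let hankel r s : M (r + q)%N s = M r (s + p)%N.
Proof. exact: moment_matrix_hankel. Qed.

Let trmT : trm T = recmx p (trm M) G S 1 := recmx_trm gb hankel.

Lemma system_is_mop : is_mop hq hp Phi B A.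
Proof.
split.
- by move=> n; apply: (gauss_borel_minor n gb).
- by apply/(lower_coefs hq); rewrite polysK.
- by apply/(lower_coefs hp); rewrite -[trm A]/(polys G) polysK.
- move=> m n; rewrite (biorthogonal_coefs hq hp fm) -[trm A]/(polys G) !polysK//.
  by rewrite -/M (gb_biorth gb).
Qed.

Lemma system_initial_conditions : initial_conditions B A xi nu.
Proof.
have init r (hr : (0 < r)%N) X : lower X ->
    Erow {poly R} (r := r) ** polys X = mapm polyC (\matrix_(i < r, j < r) X i j).
  by move=> lX; rewrite (initial_coefs (hr := hr)) polysK.
split; first exact: init.
have /(congr1 (@trm _ _ _)) := init p hp G lG; rewrite trm_mulm => ->.
by apply/funext => i; apply/funext => j; rewrite /trm /mapm !mxE.
Qed.

Lemma system_xi : nonsingular_lower xi.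
Proof.
split; first by apply/is_trig_mxP => i j ij; rewrite mxE lS.
exact: (truncmx_unit q lS) (fun k => gauss_borel_diag k gb).
Qed.

Lemma system_nu : nonsingular_lower nu.
Proof.
split; first by apply/is_trig_mxP => i j ij; rewrite mxE lG.
exact: (truncmx_unit p lG) (fun k => gauss_borel_diag k (gauss_borel_trm gb)).
Qed.

Lemma right_recurrence_coefs X (C : nat -> 'I_q -> {poly R}) : row_finite X ->
  right_recurrence X C <-> X ** coefs hq C = padcols q (coefs hq C).
Proof.
move=> fX; rewrite -coefs_scaleX -coefs_mulm//.
by split=> [->//|/coefs_inj].
Qed.

Lemma left_recurrence_coefs X (C : 'I_p -> nat -> {poly R}) : row_finite (trm X) ->
  left_recurrence X C <->
  trm X ** coefs hp (trm C) = padcols p (coefs hp (trm C)).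
Proof.
move=> fX; rewrite -coefs_scaleX -coefs_mulm//.
rewrite -[scalem 'X (trm C)]/(trm (scalem 'X C)).
by rewrite /left_recurrence left_array_mulm; split=> [->//|/coefs_inj].
Qed.

Let fT : row_finite T := recmx_row_finite q gb.

Let fT' : row_finite (trm T).
Proof. by rewrite trmT; exact: (recmx_row_finite p (gauss_borel_trm gb)). Qed.

Lemma system_recurrence : recurrence_matrix B A T.
Proof.
split; first by split; [exact: fT|exact: fT'].
- by apply/right_recurrence_coefs => //; rewrite polysK// recmx_mulS.
- apply/left_recurrence_coefs => //; rewrite -[trm A]/(polys G) polysK// trmT.
  exact: (recmx_mulS p (gauss_borel_trm gb)).
Qed.

Lemma system_recurrence_uniq T' : recurrence_matrix B A T' -> T' = T.
Proof.
move=> [[fT1 _] rT _]; apply: recmx_uniq => //.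
by move/right_recurrence_coefs : rT; rewrite polysK//; apply.
Qed.

Lemma system_right_uniq B' : right_recurrence T B' ->
  Erow {poly R} (r := q) ** B' = mapm polyC xi -> B' = B.
Proof.
move=> /right_recurrence_coefs -/(_ fT) rB' init.
apply: (@coefs_inj _ _ hq); rewrite polysK//.
apply: (recurrence_uniq gb hq rB') => n s nq.
have := system_initial_conditions.1; rewrite -init !Erow_mulm.
move=> /(congr1 (fun Z => Z (Ordinal nq) (residue hq s))) /= e.
by rewrite -[in RHS](polysK hq lS) /coefs -e.
Qed.

Lemma system_left_uniq A' : left_recurrence T A' ->
  A' ** trm (Erow {poly R} (r := p)) = mapm polyC nu^T -> A' = A.
Proof.
move=> /left_recurrence_coefs -/(_ fT'); rewrite trmT => rA' init.
rewrite -[A']trmK; congr trm.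
apply: (@coefs_inj _ _ hp); rewrite polysK//.
apply: (recurrence_uniq (gauss_borel_trm gb) hp rA') => n s np.
have := system_initial_conditions.2; rewrite -init.
move=> /(congr1 (@trm _ _ _)); rewrite !trm_mulm !trmK !Erow_mulm.
move=> /(congr1 (fun Z => Z (Ordinal np) (residue hp s))) /= e.
by rewrite -[in RHS](polysK hp lG) /coefs -e.
Qed.

(** As S and G are triangular, the corner of S N^(q n) M G^T only involves their
    leading blocks xi and nu, and the leading block of N^(q n) M is the n-th
    matrix moment. *)
Lemma system_reconstructed_moment n : reconstructed_moment xi nu T n = moment Phi n.
Proof.
rewrite /reconstructed_moment (powm_recmx q gb).
rewrite [X in _ *m X *m _](_ : _ = xi *m moment Phi n *m nu^T); last first.
  have corner (Y : 'I_q -> nat -> R) :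
      Y ** trm (Erow R (r := p)) = fun j i => Y j i.
    by have /(congr1 (@trm _ _ _)) := @Erow_mulm p R 'I_q (trm Y); rewrite trm_mulm.
  apply/matrixP => j i; rewrite mxE corner Erow_mulm /recmx.
  rewrite mxE (mulm_bound (N := p)); last first.
    by move=> l pl; rewrite /trm lG ?mulr0// (leq_trans (ltn_ord i)).
  apply: eq_bigr => l _; rewrite !mxE (mulm_bound (N := q)); last first.
    by move=> k qk; rewrite lS ?mul0r// (leq_trans (ltn_ord j)).
  congr (_ * _); apply: eq_bigr => k _; rewrite !mxE /droprows /M moment_matrixE.
  rewrite residue_ord (_ : residue hq (k + q * n) = k); last first.
    by apply: val_inj; rewrite /= mulnC addnC modnMDl modn_small.
  have -> : ((k + q * n) %/ q)%N = n by rewrite addnC mulnC quotientMD.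
  by rewrite divn_small// addn0.
have [_ uxi] := system_xi; have [_ unu] := system_nu.
by rewrite !mulmxA mulVmx// mul1mx -mulmxA -trmx_mul mulVmx// trmx1 mulmx1.
Qed.

Lemma system_reconstructed_matrix : reconstructed_matrix hq hp xi nu T = M.
Proof.
apply/funext => r; apply/funext => s.
by rewrite /reconstructed_matrix /stepline system_reconstructed_moment.
Qed.

End system.

(** * The rectangle of Christoffel transforms *)

Section chains.
Variables (R : realType) (q p : nat) (hq : (0 < q)%N) (hp : (0 < p)%N).
Variables (Psi : mxcharge R q p).
Variables (B : nat -> 'I_q -> {poly R}) (A : 'I_p -> nat -> {poly R}).
Variables (L U : nat -> nat -> nat -> R) (LL UU : nat -> nat -> nat -> nat -> R).
Let s0 := (coefs hq B, coefs hp (trm A)).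

(** The arrays of the chain are forced by the edge relations, hence they are the
    ones along the bottom side of the rectangle. *)
Lemma column_chain_edges :
    column_chain hq hp Psi B A L ->
    (forall a, (a < p)%N -> LL 0 a = L a.+1) ->
  forall a, (a < p)%N -> edge (LL 0 a) (vertex LL UU s0 0 a) (vertex LL UU s0 0 a.+1).
Proof.
move=> [Bc [Ac [B0 A0 chain]]] LLE.
have link a : (a < p)%N -> lower_bidiagonal (LL 0 a) /\
    edge (LL 0 a) (coefs hq (Bc a), coefs hp (trm (Ac a)))
                  (coefs hq (Bc a.+1), coefs hp (trm (Ac a.+1))).
  move=> ap; rewrite LLE//; have [_ _ nL AL LB] := chain a.+1 ap.
  have bL := normalized_lower_bidiagonal nL.
  by split=> //; apply/column_edge.
have vE a : (a <= p)%N ->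
    vertex LL UU s0 0 a = (coefs hq (Bc a), coefs hp (trm (Ac a))).
  elim: a => [|a IH] ap; first by rewrite /s0 -B0 -A0.
  have [bL e] := link a ap; rewrite (edge_step bL e) -IH//.
  exact: ltnW.
by move=> a ap; rewrite !vE//; [exact: (link a ap).2|exact: ltnW].
Qed.

Lemma row_chain_edges :
    row_chain hq hp Psi B A U ->
    (forall b, (b < q)%N -> lower_bidiagonal (trm (U b.+1))) ->
    (forall b, (b < q)%N -> UU b.+1 0 = U b.+1) ->
  forall b, (b < q)%N ->
    edge (trm (UU b.+1 0)) (swap_sides (vertex LL UU s0 b 0))
      (swap_sides (vertex LL UU s0 b.+1 0)).
Proof.
move=> [Bc [Ac [B0 A0 chain]]] bU UUE.
have link b : (b < q)%N ->
    edge (trm (U b.+1)) (coefs hp (trm (Ac b)), coefs hq (Bc b))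
                  (coefs hp (trm (Ac b.+1)), coefs hq (Bc b.+1)).
  move=> bq; have [_ _ _ UB AU] := chain b.+1 bq.
  by apply/row_edge; first exact: bU.
have vE b : (b <= q)%N ->
    vertex LL UU s0 b 0 = (coefs hq (Bc b), coefs hp (trm (Ac b))).
  elim: b => [|b IH] bq; first by rewrite /s0 -B0 -A0.
  rewrite /= UUE// IH; last exact: ltnW.
  by rewrite -(edge_step (bU b bq) (link b bq)).
by move=> b bq; rewrite !vE ?UUE//; [exact: link|exact: ltnW].
Qed.

End chains.

Section transport_vertex.
Variables (R : realType) (q p : nat) (LL UU : nat -> nat -> nat -> nat -> R).
Variables (Bv : nat -> nat -> nat -> 'I_q -> {poly R}).
Variables (Av : nat -> nat -> 'I_p -> nat -> {poly R}).
Hypothesis column_stepE : forall b a, (b <= q)%N -> (a < p)%N ->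
  column_step (LL b a) (to_arrays (Bv b a) (Av b a)) =
  to_arrays (Bv b a.+1) (Av b a.+1).
Hypothesis row_stepE : forall b a, (b < q)%N -> (a <= p)%N ->
  row_step (UU b.+1 a) (to_arrays (Bv b a) (Av b a)) =
  to_arrays (Bv b.+1 a) (Av b.+1 a).

(** Any path visits vertices of the rectangle only, and each of its edges
    produces the arrays attached to the next vertex. *)
Lemma transport_fromE path b a :
    (b + count_mem true path <= q)%N -> (a + count_mem false path <= p)%N ->
  transport_from LL UU b a path (to_arrays (Bv b a) (Av b a)) =
  to_arrays (Bv (b + count_mem true path) (a + count_mem false path))
            (Av (b + count_mem true path) (a + count_mem false path)).
Proof.
elim: path b a => [|[] path IH] b a /=; first by rewrite !addn0.
  rewrite add1n add0n addnS => bq ap; rewrite row_stepE.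
  - by rewrite IH ?addSn.
  - by rewrite (leq_trans _ bq)// ltnS leq_addr.
  - by rewrite (leq_trans _ ap)// leq_addr.
rewrite add1n add0n addnS => bq ap; rewrite column_stepE.
- by rewrite IH ?addSn.
- by rewrite (leq_trans _ bq)// leq_addr.
- by rewrite (leq_trans _ ap)// ltnS leq_addr.
Qed.

End transport_vertex.

Theorem theorem6p29 (R : realType) (p q : nat) (hp : (0 < p)%N) (hq : (0 < q)%N)
    (Psi : mxcharge R q p)
    (B : nat -> 'I_q -> {poly R}) (A : 'I_p -> nat -> {poly R})
    (T : nat -> nat -> R) (xi : 'M[R]_q) (nu : 'M[R]_p)
    (L U : nat -> nat -> nat -> R) (LL UU : nat -> nat -> nat -> nat -> R)
    (hmom : forall j i, finite_moments (Psi j i))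
    (hnormal : weakly_normal hq hp Psi)
    (hmop : is_mop hq hp Psi B A)
    (hT : recurrence_matrix B A T)
    (hinit : initial_conditions B A xi nu)
    (hxi : nonsingular_lower xi) (hnu : nonsingular_lower nu)
    (hL : forall a, (1 <= a <= p)%N -> positive_lower (L a))
    (hU : forall b, (1 <= b <= q)%N -> positive_upper (U b))
    (hfact : T = factor_product p q L U)
    (hcolnormal : forall a, (a <= p)%N ->
       weakly_normal hq hp (christoffel Psi 0 a))
    (hrownormal : forall b, (b <= q)%N ->
       weakly_normal hq hp (christoffel Psi b 0))
    (hcol : column_chain hq hp Psi B A L)
    (hrow : row_chain hq hp Psi B A U)
    (hedge : edge_matrices q p L U LL UU) :
  exists (Bv : nat -> nat -> nat -> 'I_q -> {poly R})
         (Av : nat -> nat -> 'I_p -> nat -> {poly R})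
         (xiv : nat -> nat -> 'M[R]_q) (nuv : nat -> nat -> 'M[R]_p)
         (Tv : nat -> nat -> nat -> nat -> R),
  forall b a, (b <= q)%N -> (a <= p)%N ->
    [/\ (* the arrays and initial conditions do not depend on the path *)
        (forall path, path_to b a path ->
           transport LL UU path (to_arrays B A) =
           to_arrays (Bv b a) (Av b a))
        /\ initial_conditions (Bv b a) (Av b a) (xiv b a) (nuv b a)
        /\ nonsingular_lower (xiv b a) /\ nonsingular_lower (nuv b a),
        (* the edge matrices are the connection matrices *)
        ((a < p)%N ->
           column_connection hq hp
             (christoffel Psi b a) (Bv b a) (Av b a)
             (christoffel Psi b a.+1) (Bv b a.+1) (Av b a.+1) (LL b a))
        /\ ((0 < b)%N ->
           row_connection hq hp
             (christoffel Psi b.-1 a) (Bv b.-1 a) (Av b.-1 a)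
             (christoffel Psi b a) (Bv b a) (Av b a) (UU b a)),
        (* Tv b a is the recurrence matrix *)
        recurrence_matrix (Bv b a) (Av b a) (Tv b a)
        /\ (forall T', recurrence_matrix (Bv b a) (Av b a) T' -> T' = Tv b a),
        (* the reconstructed moment matrix is the shifted one, and is the
           moment matrix of K_q^b dPsi (K_p^a)^T *)
        reconstructed_matrix hq hp (xiv b a) (nuv b a) (Tv b a) =
          (fun r s => moment_matrix hq hp Psi (r + b)%N (s + a)%N)
        /\ (forall j i, finite_moments (christoffel Psi b a j i))
        /\ reconstructed_matrix hq hp (xiv b a) (nuv b a) (Tv b a) =
             moment_matrix hq hp (christoffel Psi b a)
        /\ (forall n, reconstructed_moment (xiv b a) (nuv b a) (Tv b a) n =
                      moment (christoffel Psi b a) n) &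
        (* the normalized solutions of the recurrence are the mixed-type
           multiple orthogonal polynomials *)
        is_mop hq hp (christoffel Psi b a) (Bv b a) (Av b a)
        /\ (forall B', right_recurrence (Tv b a) B' ->
              Erow {poly R} (r := q) ** B' = mapm polyC (xiv b a) ->
              B' = Bv b a)
        /\ (forall A', left_recurrence (Tv b a) A' ->
              A' ** trm (Erow {poly R} (r := p)) = mapm polyC (nuv b a)^T ->
              A' = Av b a)].
Proof.
have [pLL pUU UUE LLE UUL] := hedge.
have bLL b a : (b <= q)%N -> (a < p)%N -> lower_bidiagonal (LL b a).
  by move=> bq ap; have [/normalized_lower_bidiagonal] := pLL b a bq ap.
have bUU b a : (b < q)%N -> (a <= p)%N -> lower_bidiagonal (trm (UU b.+1 a)).
  by move=> bq ap; apply: positive_upper_bidiagonal; exact: pUU.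
pose s0 := (coefs hq B, coefs hp (trm A)).
pose v := vertex LL UU s0.
have bottom_edge : forall a, (a < p)%N -> edge (LL 0 a) (v 0 a) (v 0 a.+1).
  exact: column_chain_edges hcol LLE.
have left_edge : forall b, (b < q)%N ->
    edge (trm (UU b.+1 0)) (swap_sides (v b 0)) (swap_sides (v b.+1 0)).
  apply: row_chain_edges hrow _ _ => b bq; last exact: UUE.
  by apply: positive_upper_bidiagonal; exact: hU.
have [_ spB spA bi] := hmop.
have lB : lower (coefs hq B) by apply/lower_coefs.
have lA : lower (coefs hp (trm A)) by apply/lower_coefs.
have gb0 : gauss_borel (moment_matrix hq hp Psi) s0.1 s0.2.
  split=> //; apply/funext => m; apply/funext => n.
  by rewrite -biorthogonal_coefs//; exact: bi.
have comm b a : (b < q)%N -> (a < p)%N ->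
    UU b.+1 a ** LL b a = LL b.+1 a ** UU b.+1 a.+1.
  by move=> bq ap; exact: UUL.
pose M b a := moment_matrix hq hp (christoffel Psi b a).
have ME b a : M b a = fun r s => moment_matrix hq hp Psi (r + b) (s + a).
  apply/funext => r; apply/funext => s; exact: moment_matrix_christoffel.
have gb b a : (b <= q)%N -> (a <= p)%N -> gauss_borel (M b a) (v b a).1 (v b a).2.
  move=> bq ap; rewrite ME.
  exact: (rectangle_gauss_borel bLL bUU comm bottom_edge left_edge gb0 bq ap).
pose Bv b a := polys (r := q) (v b a).1.
pose Av b a := trm (polys (r := p) (v b a).2).
have vE b a : (b <= q)%N -> (a <= p)%N ->
    v b a = (coefs hq (Bv b a), coefs hp (trm (Av b a))).
  move=> bq ap; have [lS lG _] := gb b a bq ap.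
  by rewrite -[trm (Av b a)]/(polys _) !polysK// -surjective_pairing.
have cedge b a : (b <= q)%N -> (a < p)%N ->
    edge (LL b a) (coefs hq (Bv b a), coefs hp (trm (Av b a)))
      (coefs hq (Bv b a.+1), coefs hp (trm (Av b a.+1))).
  move=> bq ap; rewrite -!vE//; last exact: ltnW.
  exact: (rectangle_edges bLL bUU comm bottom_edge left_edge bq).1.
have redge b a : (b < q)%N -> (a <= p)%N ->
    edge (trm (UU b.+1 a)) (coefs hp (trm (Av b a)), coefs hq (Bv b a))
      (coefs hp (trm (Av b.+1 a)), coefs hq (Bv b.+1 a)).
  move=> bq ap.
  have := (rectangle_edges bLL bUU comm bottom_edge left_edge (ltnW bq)).2 bq a ap.
  by rewrite -/v !vE//; exact: ltnW.
have fm b a := finite_moments_christoffel hmom b a.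
have mop b a : (b <= q)%N -> (a <= p)%N ->
    is_mop hq hp (christoffel Psi b a) (Bv b a) (Av b a).
  by move=> bq ap; apply: system_is_mop => //; exact: gb.
exists Bv, Av, (fun b a => \matrix_(i, j) (v b a).1 i j),
  (fun b a => \matrix_(i, j) (v b a).2 i j),
  (fun b a => recmx q (M b a) (v b a).1 (v b a).2 1).
move=> b a bq ap; have gba := gb b a bq ap; split.
- split; last split; last split.
  + move=> path [pb pa].
    have -> : to_arrays B A = to_arrays (Bv 0 0) (Av 0 0).
      by rewrite /Bv /Av /v /= (coefsK lB) (coefsK lA).
    have := @transport_fromE R q p LL UU Bv Av _ _ path 0 0.
    rewrite !add0n pb pa; apply=> // b' a' bq' ap'.
      exact: column_step_edge (bLL _ _ bq' ap') (cedge _ _ bq' ap').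
    exact: row_step_edge (bUU _ _ bq' ap') (redge _ _ bq' ap').
  + exact: system_initial_conditions gba.
  + exact: system_xi gba.
  + exact: system_nu gba.
- split=> [ap'|b0].
    have /column_edge-/(_ (bLL b a bq ap'))[AL LB] := cedge b a bq ap'.
    by split=> //; [exact: mop|exact: mop|exact: (pLL b a bq ap').1].
  case: b b0 bq gba => // b _ bq gba /=.
  have /row_edge-/(_ (bUU b a bq ap))[UB AU] := redge b a bq ap.
  by split=> //; [exact/mop/ap/ltnW|exact: mop|exact: (pUU b.+1 a bq ap).1].
- split; first exact: system_recurrence.
  by move=> T'; exact: system_recurrence_uniq.
- split; last split; last split.
  + by rewrite system_reconstructed_matrix// -ME.
  + by move=> j i; exact: fm.
  + exact: system_reconstructed_matrix.
  + by move=> n; exact: system_reconstructed_moment.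
- split; first exact: mop.
  split.
  + by move=> B'; exact: system_right_uniq.
  + by move=> A'; exact: system_left_uniq.
Qed.
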